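(* Let $\Gamma$ be a metric graph, $v\in\Gamma$ and $A$ a nonempty subset of $\Gamma$. If every special open set $U$ with $v\in U$ satisfies $A\cap U\neq\emptyset$, then $v\in\mathcal L(A)$. Moreover, $\mathcal L(A)\supseteq\bigcap_{U\in\mathcal S_\Gamma,\,U\cap A=\emptyset}(\Gamma\setminus U)$. In addition, if every nonempty special open set on $\Gamma$ intersects $A$, then $A$ is a rank-determining set of $\Gamma$.
   Context: A metric graph $\Gamma$ is the geometric realization of a finite connected loopless multigraph with each edge identified with a closed interval of positive length. Divisors are elements of the free abelian group on the points of $\Gamma$; rational functions are continuous piecewise linear functions with integral slopes, $(f)=\sum_v\mathrm{ord}_vf\,(v)$ with $\mathrm{ord}_vf$ the sum of outgoing slopes at $v$; $D\sim D'$ iff $D-D'=(f)$; $|D|$ is the set of effective divisors linearly equivalent to $D$. $\mathrm{supp}\,D=\{v:D(v)\ne0\}$ and $\mathrm{supp}|D|=\bigcup_{D'\in|D|}\mathrm{supp}\,D'$. For nonempty $A\subseteq\Gamma$, $\mathcal L(A)$ is the set of $v\in\Gamma$ such that for every divisor $D$, $A\subseteq\mathrm{supp}|D|$ implies $v\in\mathrm{supp}|D|$. For a closed $X\subseteq\Gamma$ with finitely many components and $v\in\partial X$, $\mathrm{outdeg}_X(v)$ is the maximum number of internally disjoint segments of $\Gamma\setminus X$ with an open end at $v$. A special open set is a connected open $U\subseteq\Gamma$ such that $U=\emptyset$, or $U=\Gamma$, or every connected component $X$ of $\Gamma\setminus U$ contains a boundary point $v$ with $\mathrm{outdeg}_X(v)\ge2$;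 $\mathcal S_\Gamma$ is the set of special open sets. Rank: $r(D)=-1$ if $|D|=\emptyset$, otherwise $r(D)\ge s\ge0$ iff $|D-E|\ne\emptyset$ for all effective $E$ of degree $s$; $r_A(D)$ is the same with $E$ supported on $A$; $A$ is rank-determining if $r(D)=r_A(D)$ for all $D$. *)

(* Defs.v *)
From HB Require Import structures.
From mathcomp Require Import all_boot all_order all_algebra.
From mathcomp Require Import all_classical all_reals all_analysis.
From mathcomp Require Import freeg.

Set Implicit Arguments.
Unset Strict Implicit.
Unset Printing Implicit Defensive.

Import Order.TTheory GRing.Theory Num.Theory.
Import numFieldNormedType.Exports.

Local Open Scope classical_set_scope.
Local Open Scope ring_scope.

(* The orientation of the edges given by src and tgt is arbitrary and only    *)
(* serves to identify the edge e with the interval [0, len e].                *)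
Record metric_graph (R : realType) := MetricGraph {
  vert : finType;
  edge : finType;
  src : edge -> vert;
  tgt : edge -> vert;
  len : edge -> R;
  len_gt0 : forall e, 0 < len e;
  loopless : forall e, src e != tgt e;
  vert_inhabited : (0 < #|vert|)%N;
  graph_connected : forall u v : vert,
    connect [rel x y | [exists e, ((src e == x) && (tgt e == y))
                               || ((src e == y) && (tgt e == x))]] u v }.

Section GeometricRealization.
Context {R : realType} (G : metric_graph R).

(* A point of the realization is either a vertex or a pair (e, t) with        *)
(* 0 < t < len e: the normal forms of the quotient of the disjoint union of   *)
(* the vertices and of the intervals [0, len e] under the identifications     *)
(* (e, 0) = src e and (e, len e) = tgt e.                                     *)
Definition is_point (p : vert G + edge G * R) : bool :=
  if p is inr (e, t) then (0 < t) && (t < len e) else true.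

Record gpoint := Point { pval : vert G + edge G * R; _ : is_point pval }.

HB.instance Definition _ := [isSub for pval].
HB.instance Definition _ := [Choice of gpoint by <:].

Definition vpoint (v : vert G) : gpoint := @Point (inl v) isT.

(* The quotient map from [0, len e], extended to R by constants outside       *)
(* [0, len e]; the first argument of insubd is its default, for t <= 0.       *)
Definition chart (e : edge G) (t : R) : gpoint :=
  if len e <= t then vpoint (tgt e) else insubd (vpoint (src e)) (inr (e, t)).

(* Quotient topology. Since chart e factors through the retraction of R onto  *)
(* [0, len e], openness of the preimage in R is openness in [0, len e].       *)
Definition point_open (U : set gpoint) : Prop :=
  forall e, open (chart e @^-1` U).

Let point_openT : point_open setT.
Proof. by move=> e; rewrite preimage_setT; exact: openT. Qed.

Let point_openI (U V : set gpoint) :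
  point_open U -> point_open V -> point_open (U `&` V).
Proof. by move=> Uo Vo e; rewrite preimage_setI; exact: openI. Qed.

Let point_open_bigU (I : Type) (F : I -> set gpoint) :
  (forall i, point_open (F i)) -> point_open (\bigcup_i F i).
Proof.
move=> Fo e; rewrite preimage_bigcup; apply: bigcup_open => i _; exact: Fo.
Qed.

HB.instance Definition _ :=
  isOpenTopological.Build gpoint point_openT point_openI point_open_bigU.

End GeometricRealization.

Section Divisors.
Context {R : realType} {G : metric_graph R}.
Implicit Types (f : gpoint G -> R) (x v : gpoint G) (A : set (gpoint G)).

Definition divisor := {freeg (gpoint G) / int}.
Implicit Types D E : divisor.

Definition effective D : Prop := forall x, 0 <= coeff x D.

Definition supp D : set (gpoint G) := [set x | coeff x D != 0].

Definition piecewise_linear (e : edge G) f : Prop :=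
  exists s : seq R, itv_partition 0 (len e) s /\
    forall i, (i < size s)%N ->
      let a := nth 0 (0 :: s) i in let b := nth 0 (0 :: s) i.+1 in
      exists k : int, forall t, a <= t <= b ->
        f (chart e t) = f (chart e a) + k%:~R * (t - a).

Definition rational_function f : Prop :=
  continuous f /\ forall e, piecewise_linear e f.

(* The integral slope at 0+ of g, for g linear on some [0, eps].              *)
Definition slope (g : R -> R) : int :=
  xget 0 [set k : int | \forall h \near 0^'+, g h = g 0 + k%:~R * h].

Definition fwd_slope f (e : edge G) (t : R) : int :=
  slope (fun h => f (chart e (t + h))).

Definition bwd_slope f (e : edge G) (t : R) : int :=
  slope (fun h => f (chart e (t - h))).

Definition ord f x : int :=
  match pval x with
  | inl w => \sum_(e | src e == w) fwd_slope f e 0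
           + \sum_(e | tgt e == w) bwd_slope f e (len e)
  | inr (e, t) => fwd_slope f e t + bwd_slope f e t
  end.

(* D = (f), stated coefficientwise.                                           *)
Definition is_div f D : Prop := forall x, coeff x D = ord f x.

Definition lin_equiv D D' : Prop :=
  exists2 f, rational_function f & is_div f (D - D').

Definition linsys D : set divisor :=
  [set D' | effective D' /\ lin_equiv D D'].

Definition supp_linsys D : set (gpoint G) := \bigcup_(D' in linsys D) supp D'.

Definition Lset A : set (gpoint G) :=
  [set v | forall D, A `<=` supp_linsys D -> supp_linsys D v].

(* The relative rank r_A(D); the supremum of extended reals is the largest s, *)
(* which exists as soon as A is nonempty.                                     *)
Definition rank_on A D : \bar R :=
  if `[< linsys D = set0 >] then (-1)%:E
  else ereal_sup [set s%:R%:E | s in [set s : nat |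
         forall E, effective E -> supp E `<=` A -> deg E = s%:Z ->
           linsys (D - E) !=set0]].

Definition rank D : \bar R := rank_on setT D.

Definition rank_determining A : Prop := forall D, rank D = rank_on A D.

End Divisors.
Arguments divisor {R} G.

Section SpecialOpenSets.
Context {R : realType} {G : metric_graph R}.
Implicit Types (v : gpoint G) (U X S : set (gpoint G)).

Definition boundary X : set (gpoint G) := closure X `\` X°.

(* S is the interior of an arc (homeomorphic image of [0, 1]) starting at v.  *)
Definition segment_from v S : Prop :=
  exists gamma : R -> gpoint G,
    [/\ {within `[0, 1], continuous gamma},
        {in `[0, 1] &, injective gamma},
        gamma 0 = v & S = gamma @` `]0, 1[].

(* The supremum is a maximum: at most as many disjoint segments start at v as *)
(* there are tangent directions at v.                                         *)
Definition outdeg X v : \bar R :=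
  ereal_sup [set n%:R%:E | n in [set n : nat |
    exists S : 'I_n -> set (gpoint G),
      (forall i, segment_from v (S i) /\ S i `<=` ~` X) /\ trivIset setT S]].

Definition special_open U : Prop :=
  [/\ open U, connected U &
      [\/ U = set0, U = setT |
          forall x, ~ U x ->
            let X := connected_component (~` U) x in
            exists2 v, (X `&` boundary X) v & (2%:E <= outdeg X v)%E]].

End SpecialOpenSets.

(* Main.v *)
(* Suppose A is contained in supp|D| but v is not in it. Let f0 be the        *)
(* pointwise supremum of the functions f with D + (f) >= 0 and f(v) = 0. It   *)
(* is finite: M - f is superharmonic off supp D when M bounds f, so a Harnack *)
(* inequality, chained over the compact connected graph, bounds the           *)
(* oscillation of f by a constant depending on D only. It is again piecewise  *)
(* linear with integral slopes, because near each point the f are convex      *)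
(* along every tangent direction with integral subgradients from one finite   *)
(* set, a property that passes to suprema. Hence D0 = D + (f0) is effective   *)
(* and every g with D0 + (g) >= 0 attains its maximum at v (D0 is v-reduced). *)
(* Let U be the component of v in the complement of supp D0. If U were not    *)
(* special, some component X of its complement would have all its outdegrees  *)
(* at most 1, and firing X by a small amount would give a g that is larger on *)
(* X than at v. So U is special and contains some a in A; choosing D0 + (g)   *)
(* in |D| with a in its support, the maximum principle makes g constant on U, *)
(* which contradicts D0(a) = 0. Finally, if every point lies in L(A), the     *)
(* points of an effective divisor can be moved into A one at a time, so that  *)
(* r_A = r.                                                                   *)

Require Import Defs.
From mathcomp Require Import all_boot all_order all_algebra.
From mathcomp Require Import all_classical all_reals all_analysis.
From mathcomp Require Import freeg lra zify.

Set Implicit Arguments.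
Unset Strict Implicit.
Unset Printing Implicit Defensive.

Import Order.TTheory GRing.Theory Num.Theory.
Import numFieldNormedType.Exports.

Local Open Scope classical_set_scope.
Local Open Scope ring_scope.

Lemma common_eps (R : realType) (T : eqType) (s : seq T) (Q : T -> R -> Prop) :
  (forall t, t \in s -> exists2 eps, 0 < eps & Q t eps) ->
  (forall t eps eps', 0 < eps' -> eps' <= eps -> Q t eps -> Q t eps') ->
  exists2 eps, 0 < eps & forall t, t \in s -> Q t eps.
Proof.
move=> Qs Qle; elim: s Qs => [|a s ih] Qs; first by exists 1.
have [|e e0 es] := ih; first by move=> t ts; apply: Qs; rewrite inE ts orbT.
have [e' e'0 ea] := Qs a (mem_head _ _).
have m0 : 0 < Num.min e e' by rewrite lt_min e0.
exists (Num.min e e') => // t; rewrite inE => /orP[/eqP ->|ts].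
  by apply: Qle ea => //; rewrite ge_min lexx orbT.
by apply: Qle (es _ ts) => //; rewrite ge_min lexx.
Qed.

(** * Tangent directions and the topology of the graph *)

Section Directions.
Context {R : realType} {G : metric_graph R}.
Implicit Types (x y : gpoint G) (d : edge G * bool) (e : edge G) (h t : R).
Implicit Types (U : set (gpoint G)).

Lemma chart_le0 e t : t <= 0 -> chart e t = vpoint (src e).
Proof.
move=> t0; have l0 := len_gt0 e; rewrite /chart leNgt (le_lt_trans t0 l0) /=.
by rewrite /insubd insubN//= ltNge t0.
Qed.

Lemma chart_ge_len e t : len e <= t -> chart e t = vpoint (tgt e).
Proof. by rewrite /chart => ->. Qed.

Lemma pval_chart e t : 0 < t < len e -> pval (chart e t) = inr (e, t).
Proof.
move=> t0; rewrite /chart leNgt; case/andP: (t0) => _ -> /=.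
by rewrite -[pval _]/(val _) insubdK.
Qed.

Lemma chartK x e t : pval x = inr (e, t) -> 0 < t < len e /\ chart e t = x.
Proof.
case: x => p px /= E; move: px; rewrite E => px; split => //.
by apply: val_inj; rewrite /= pval_chart.
Qed.

(* A tangent direction at a point is an edge together with a sense of travel: *)
(* [true] towards the target of the edge, [false] towards its source.         *)
Definition dirs x d : bool :=
  match pval x with
  | inl w => (if d.2 then src d.1 else tgt d.1) == w
  | inr (e, _) => d.1 == e
  end.

Definition pos x d : R :=
  match pval x with
  | inl _ => if d.2 then 0 else len d.1
  | inr (_, t) => t
  end.

Definition ray x d h : gpoint G :=
  chart d.1 (if d.2 then pos x d + h else pos x d - h).

Definition room x d : R := if d.2 then len d.1 - pos x d else pos x d.

Definition opp d : edge G * bool := (d.1, ~~ d.2).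

Lemma room_gt0 x d : dirs x d -> 0 < room x d.
Proof.
rewrite /dirs /room /pos; case E: (pval x) => [w|[e t]].
  by case: d.2; rewrite ?subr0 len_gt0.
by move=> /eqP ->; have [/andP[t0 tl] _] := chartK E; case: d.2; rewrite ?subr_gt0.
Qed.

Lemma ray0 x d : dirs x d -> ray x d 0 = x.
Proof.
rewrite /dirs /ray /pos; case E: (pval x) => [w|[e t]].
  move=> /eqP dw; apply: val_inj => /=; rewrite E -dw.
  case: d.2; rewrite (addr0, subr0); last by rewrite chart_ge_len.
  by rewrite chart_le0.
by move=> /eqP ->; rewrite addr0 subr0 if_same; case: (chartK E).
Qed.

Lemma pos_itv x d : dirs x d ->
  if d.2 then 0 <= pos x d < len d.1 else 0 < pos x d <= len d.1.
Proof.
rewrite /dirs /pos; case E: (pval x) => [w|[e t]].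
  by case: d.2; rewrite lexx len_gt0.
by move=> /eqP ->; have [/andP[t0 tl] _] := chartK E; case: d.2; rewrite ?t0 ?tl ltW.
Qed.

Lemma pval_ray x d h : dirs x d -> 0 < h < room x d ->
  pval (ray x d h) = inr (d.1, if d.2 then pos x d + h else pos x d - h).
Proof.
move=> xd /andP[h0 hr]; rewrite /ray pval_chart//.
by move: (pos_itv xd) hr; rewrite /room; case: d.2; lra.
Qed.

Lemma dirs_ray x d h d' : dirs x d -> 0 < h < room x d ->
  dirs (ray x d h) d' = (d' == d) || (d' == opp d).
Proof.
move=> xd hr; rewrite /dirs pval_ray// /opp.
case: d {hr xd} => e b; case: d' => e' b' /=; rewrite !xpair_eqE.
by case: eqP => //=; case: b; case: b'.
Qed.

Lemma ray_ray x d h k : dirs x d -> 0 < h < room x d ->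
  ray (ray x d h) d k = ray x d (h + k).
Proof.
move=> xd hr; rewrite {1}/ray /pos pval_ray// /ray.
by case: d.2; congr chart; lra.
Qed.

Lemma ray_ray_opp x d h k : dirs x d -> 0 < h < room x d ->
  ray (ray x d h) (opp d) k = ray x d (h - k).
Proof.
move=> xd hr; rewrite {1}/ray /pos pval_ray// /ray /opp /=.
by case: d.2 => /=; congr chart; lra.
Qed.

Lemma open_gpoint U : point_open U -> open U.
Proof. exact. Qed.

Lemma radial_open U :
  (forall x, U x -> exists2 eps, 0 < eps &
     forall d h, dirs x d -> 0 <= h -> h < eps -> U (ray x d h)) -> open U.
Proof.
move=> Ur; apply: open_gpoint => e; rewrite openE => t /= Ut; have [eps e0 He] := Ur _ Ut.
rewrite /interior; apply/nbhs_ballP; exists eps => //= s; rewrite /ball/= => ts.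
have l0 := len_gt0 e; have := ts; rewrite ltr_norml => /andP[ts1 ts2].
have [t0|t0] := leP t 0.
  have E := chart_le0 e t0; rewrite /preimage/=.
  have [s0|s0] := leP s 0; first by rewrite chart_le0// -E.
  have := He (e, true) s; rewrite /ray/pos /dirs E/= eqxx add0r.
  by apply => //; lra.
have [tl|tl] := leP (len e) t.
  have E := chart_ge_len tl; rewrite /preimage/=.
  have [s0|s0] := leP (len e) s; first by rewrite chart_ge_len// -E.
  have := He (e, false) (len e - s); rewrite /ray/pos /dirs E/= eqxx subKr.
  by apply => //; lra.
have E : pval (chart e t) = inr (e, t) by rewrite pval_chart ?t0.
have [st|st] := leP t s; rewrite /preimage/=.
  have := He (e, true) (s - t); rewrite /ray/pos /dirs E/= eqxx subrKC.
  by apply => //; lra.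
have := He (e, false) (t - s); rewrite /ray/pos /dirs E/= eqxx subKr.
by apply => //; lra.
Qed.

Lemma nbhs_radial x U : nbhs x U <-> U x /\ exists2 eps, 0 < eps &
  forall d h, dirs x d -> 0 <= h -> h < eps -> U (ray x d h).
Proof.
split=> [|[Ux [eps e0 He]]].
  rewrite nbhsE => -[B [Bo Bx] BU]; split; first exact: BU.
  have [|t a b b0 ba Q|eps e0 He] := @common_eps R _ (enum {: edge G * bool})
      (fun d eps => forall h, dirs x d -> 0 <= h -> h < eps -> B (ray x d h)).
  - move=> d _; have [xd|xd] := boolP (dirs x d); last by exists 1.
    have := Bo d.1; rewrite openE => /(_ (pos x d)).
    have /[swap]/[apply] : (chart d.1 @^-1` B) (pos x d).
      by move: (ray0 xd); rewrite /ray addr0 subr0 if_same /preimage/= => ->.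
    rewrite /interior => /nbhs_ballP[eps/= e0 He]; exists eps => // h _ h0 he.
    apply: He; rewrite /ball/= -normrN opprB.
    by case: d.2; rewrite ltr_norml; lra.
  - by move=> h xd h0 hb; apply: Q => //; apply: lt_le_trans ba.
  - exists eps => // d h xd h0 he; apply/BU/He => //.
    by rewrite mem_enum.
have [|t a b b0 ba Q|eps1 e10 He1] := @common_eps R _ (enum {: edge G * bool})
      (fun d eps => dirs x d -> eps <= room x d).
- move=> d _; have [xd|xd] := boolP (dirs x d); last by exists 1.
  by exists (room x d) => //; exact: room_gt0.
- by move=> xd; rewrite (le_trans ba)// Q.
set r := Num.min eps eps1.
have r0 : 0 < r by rewrite lt_min e0.
pose V := [set y | y = x \/ exists d h, [/\ dirs x d, 0 <= h, h < r & y = ray x d h]].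
have VU : V `<=` U.
  move=> y [->//|[d [h [xd h0 hr ->]]]]; apply: He => //.
  by rewrite (lt_le_trans hr)// ge_min lexx.
rewrite nbhsE; exists V => //; split; last by left.
apply: radial_open => y.
have Vx : exists2 eps, 0 < eps &
    forall d h, dirs x d -> 0 <= h -> h < eps -> V (ray x d h).
  by exists r => // d h xd h0 hr; right; exists d, h.
case=> [->//|[d [h [xd h0 hr ->]]]].
have := h0; rewrite le_eqVlt => /predU1P[<-|{}h0]; first by rewrite ray0.
have hrm : 0 < h < room x d.
  rewrite h0 (lt_le_trans hr)// (@le_trans _ _ eps1)//.
    by rewrite ge_min lexx orbT.
  by apply: He1 => //; rewrite mem_enum.
exists (Num.min h (r - h)); first by rewrite lt_min h0 subr_gt0.
move=> d' k; rewrite dirs_ray// lt_min => /orP[]/eqP -> k0 /andP[kh kr].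
  by rewrite ray_ray//; right; exists d, (h + k); split => //; lra.
by rewrite ray_ray_opp//; right; exists d, (h - k); split => //; lra.
Qed.

Lemma chart_continuous e : continuous (chart e).
Proof. by apply/continuousP => U; exact. Qed.

Lemma vpointP x w : pval x = inl w -> x = vpoint w.
Proof. by move=> E; apply: val_inj. Qed.

Lemma gpoint_cover x :
  (exists w, x = vpoint w) \/ exists e t, 0 < t < len e /\ x = chart e t.
Proof.
case E: (pval x) => [w|[e t]]; first by left; exists w; exact: vpointP.
by right; exists e, t; have [? ?] := chartK E.
Qed.

(* [Q c y] reads "the bound [c] is valid at [y]", and [jn] merges bounds.     *)
Lemma uniform_bound (T : Type) (jn : T -> T -> T) (Q : T -> gpoint G -> Prop) :
  (forall c c' y, Q c y -> Q (jn c c') y) ->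
  (forall c c' y, Q c' y -> Q (jn c c') y) ->
  (forall x, exists c, \forall y \near x, Q c y) ->
  exists c, forall y, Q c y.
Proof.
move=> jl jr loc.
have v0 : vert G by have /card_gt0P/sigW[v _] := vert_inhabited G.
have [c0 _] := loc (vpoint v0).
have fin (I : eqType) (s : seq I) (P : I -> gpoint G -> Prop) :
    (forall i, i \in s -> exists c, forall y, P i y -> Q c y) ->
    exists c, forall i y, i \in s -> P i y -> Q c y.
  elim: s => [|a s ih] Hs; first by exists c0.
  have [|c hc] := ih; first by move=> i si; apply: Hs; rewrite inE si orbT.
  have [c' hc'] := Hs a (mem_head _ _); exists (jn c c') => i y.
  by rewrite inE => /orP[/eqP ->|is_] Py; [apply/jr/hc'|apply/jl/(hc i)].
have edg e : exists c, forall t, 0 <= t <= len e -> Q c (chart e t).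
  pose P := [set b | 0 <= b <= len e /\ exists c, forall t, 0 <= t <= b -> Q c (chart e t)].
  have P0 : P 0.
    split; first by rewrite lexx ltW// len_gt0.
    have [c /nbhs_singleton cx] := loc (chart e 0); exists c => t.
    by rewrite -eq_le => /eqP <-.
  have Pub : has_sup P.
    by split; [exists 0|exists (len e) => b [/andP[]]].
  set b := sup P.
  have b0 : 0 <= b by apply: (sup_ubound Pub.2).
  have bl : b <= len e by apply: ge_sup; [exists 0|move=> ? [/andP[]]].
  have [c /chart_continuous] := loc (chart e b); rewrite /nbhs/= => /nbhs_ballP[eps/= eps0 He].
  have [b' [/andP[b'0 b'l] [c' hc']] bb'] := sup_adherent eps0 Pub.
  have Pb : forall s, s < b + eps -> 0 <= s <= len e -> P s.
    move=> s sb sl; split=> //; exists (jn c c') => t ts.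
    have [tb'|tb'] := leP t b'; first by apply/jr/hc'; lra.
    by apply/jl/He; rewrite /ball/= ltr_norml -/b in bb' *; lra.
  suff -> : len e = b by have [] : P b by apply: Pb; lra.
  apply/eqP; rewrite eq_le bl andbT leNgt; apply/negP => bl'.
  have : P (Num.min (len e) (b + eps / 2)).
    by apply: Pb; [rewrite gt_min; apply/orP; right; lra|
                   rewrite le_min ge_min lexx/=; lra].
  move=> /(sup_ubound Pub.2); rewrite -/b ge_min; lra.
have [|c hc] := @fin _ (enum (edge G)) (fun e y => exists2 t, 0 <= t <= len e & y = chart e t).
  by move=> e _; have [c hc] := edg e; exists c => y [t ? ->]; exact: hc.
have [|c' hc'] := @fin _ (enum (vert G)) (fun w y => y = vpoint w).
  by move=> w _; have [c' /nbhs_singleton ?] := loc (vpoint w); exists c' => y ->.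
exists (jn c c') => y; have [[w ->]|[e [t [/andP[? ?] ->]]]] := gpoint_cover y.
  by apply/jr/(hc' w) => //; rewrite mem_enum.
apply/jl/(hc e); first by rewrite mem_enum.
by exists t => //; rewrite !ltW.
Qed.

Lemma compact_gpoint : compact [set: gpoint G].
Proof.
rewrite compact_near_coveringP => I F P FF loc.
suff [A [FA HA]] : exists A, F A /\ forall y i, A i -> P i y.
  by near=> i => y _; apply: HA; near: i.
have [|||A HA] := @uniform_bound {A : set I | F A}
   (fun A B => exist _ (sval A `&` sval B) (filterI (svalP A) (svalP B)))
   (fun A y => forall i, sval A i -> P i y).
- by move=> c c' y H i [/H].
- by move=> c c' y H i [_ /H].
- move=> x; have [[V B]/= [Vx FB] HVB] := loc x Logic.I.
  exists (exist _ B FB); apply: filterS Vx => y Vy i Bi.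
  by exact: (HVB (y, i)).
by exists (sval A); split; [exact: svalP|move=> y i Ai; exact: HA].
Unshelve. all: by end_near.
Qed.

Lemma connected_gpoint (S : set (gpoint G)) : open S -> open (~` S) -> forall x y,
  S x -> S y.
Proof.
move=> So Sc.
have chS e s t : S (chart e s) -> S (chart e t).
  have := @connected_continuous_connected _ _ setT (chart e).
  have cR : connected [set: R^o] by apply/connected_intervalP.
  move=> /(_ cR) /(_ (continuous_subspaceT (@chart_continuous e))) cc Ss.
  have : chart e @` setT `&` S = chart e @` setT.
    apply: cc; first by exists (chart e s); split => //; exists s.
      by exists S.
    by exists S => //; rewrite -(setCK S); exact: open_closedC.
  by move=> E; have [] : (chart e @` setT `&` S) (chart e t) by rewrite E; exists t.
have srcS e : S (vpoint (src e)) <-> S (vpoint (tgt e)).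
  by rewrite -(chart_le0 e (lexx 0)) -(chart_ge_len (lexx (len e))); split; apply: chS.
have vv u w : S (vpoint u) -> S (vpoint w).
  have /connectP[p] := graph_connected u w; elim: p u => [|a p ih] u /=.
    by move=> _ ->.
  move=> /andP[/existsP[e ue] pp] lw Su; apply: (ih a) => //.
  case/orP: ue => /andP[/eqP E1 /eqP E2]; move: Su; rewrite -E1 -E2.
    by move/srcS.
  by move/srcS.
have toV x : exists w, S x <-> S (vpoint w).
  have [[w ->]|[e [t [_ ->]]]] := gpoint_cover x; first by exists w.
  by exists (src e); rewrite -(chart_le0 e (lexx 0)); split; apply: chS.
move=> x y Sx; have [w xw] := toV x; have [u yu] := toV y.
by apply/yu/(vv w)/xw.
Qed.

End Directions.

(** * Piecewise linear functions and their divisors *)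

Section PiecewiseLinear.
Context {R : realType} {G : metric_graph R}.
Implicit Types (x y : gpoint G) (d : edge G * bool) (e : edge G) (h t : R).
Implicit Types (f g : gpoint G -> R) (u : R -> R) (k : int).

Definition germ u k :=
  exists2 eps, 0 < eps & forall h, 0 <= h <= eps -> u h = u 0 + k%:~R * h.

Definition pl f := forall x d, dirs x d -> exists k, germ (fun h => f (ray x d h)) k.

Definition sl f x d : int := slope (fun h => f (ray x d h)).

Lemma germ_slope u k : germ u k -> slope u = k.
Proof.
case=> eps e0 He; rewrite /slope.
have gk : \forall h \near 0^'+, u h = u 0 + k%:~R * h.
  near=> h; apply: He; apply/andP; split; first by near: h; exact: nbhs_right_ge.
  by near: h; exact: nbhs_right_le.
apply: xget_unique => // k' gk'.
have [h [h0 [E1 E2]]] : exists h : R, 0 < h /\ (u h = u 0 + k%:~R * h /\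
    u h = u 0 + k'%:~R * h).
  apply: (@filter_ex _ 0^'+); near=> h; split; last by split; near: h.
  by near: h; exact: nbhs_right_gt.
by move: E2; rewrite E1 => /addrI /(mulIf (lt0r_neq0 h0)) /eqP; rewrite eqr_int => /eqP.
Unshelve. all: by end_near.
Qed.

Lemma slP f x d : pl f -> dirs x d -> exists2 eps, 0 < eps &
  forall h, 0 <= h <= eps -> f (ray x d h) = f x + (sl f x d)%:~R * h.
Proof.
move=> fpl xd; have [k gk] := fpl _ _ xd; rewrite /sl (germ_slope gk).
by case: gk => eps e0 He; exists eps => // h /He; rewrite ray0.
Qed.

Lemma pl_star f x : pl f -> exists2 eps, 0 < eps & forall d, dirs x d ->
  forall h, 0 <= h <= eps -> f (ray x d h) = f x + (sl f x d)%:~R * h.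
Proof.
move=> fpl.
have [|d a b b0 ba Q|eps e0 He] := @common_eps R _ (enum {: edge G * bool}) (fun d eps =>
  dirs x d -> forall h, 0 <= h <= eps -> f (ray x d h) = f x + (sl f x d)%:~R * h).
- move=> d _; have [xd|xd] := boolP (dirs x d); last by exists 1.
  by have [eps e0 He] := slP fpl xd; exists eps.
- by move=> xd h hb; apply: Q => //; lra.
- by exists eps => // d; apply: He; rewrite mem_enum.
Qed.

Lemma ordE f x : ord f x = \sum_(d | dirs x d) sl f x d.
Proof.
have -> : \sum_(d | dirs x d) sl f x d =
    \sum_e (\sum_(b | dirs x (e, b)) sl f x (e, b)).
  by rewrite pair_big_dep; apply: eq_big => -[].
under eq_bigr do rewrite big_mkcond big_bool.
rewrite big_split/= -!big_mkcond/= /ord /dirs /sl /ray /pos.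
case: (pval x) => [w|[e t]] //=.
by rewrite !(big_pred1 e) => [|i|i]; rewrite // eq_sym.
Qed.

Lemma ord_ray f x d h : dirs x d -> 0 < h < room x d ->
  ord f (ray x d h) = sl f (ray x d h) d + sl f (ray x d h) (opp d).
Proof.
move=> xd hr; have dd : opp d != d by case: d {xd hr} => e [];
  rewrite /opp xpair_eqE/= eqxx.
rewrite ordE (bigD1 d)/= ?dirs_ray ?eqxx//; congr (_ + _).
rewrite (bigD1 (opp d))/= ?dirs_ray ?eqxx ?orbT ?dd// big_pred0 ?addr0// => d'.
by rewrite dirs_ray//; case: eqP => //= _; case: eqP.
Qed.

Lemma germD u v k l : germ u k -> germ v l -> germ (fun h => u h + v h) (k + l).
Proof.
move=> [a a0 Ha] [b b0 Hb]; exists (Num.min a b); first by rewrite lt_min a0.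
move=> h /andP[h0]; rewrite le_min => /andP[ha hb].
by rewrite Ha ?h0// Hb ?h0// intrD mulrDl addrACA.
Qed.

Lemma germN u k : germ u k -> germ (fun h => - u h) (- k).
Proof.
by move=> [a a0 Ha]; exists a => // h /Ha ->; rewrite intrN mulNr opprD.
Qed.

Lemma germ_cst (c : R) : germ (fun=> c) 0.
Proof. by exists 1 => // h _; rewrite mul0r addr0. Qed.

Lemma pl_cst (c : R) : pl (fun=> c).
Proof. by move=> x d _; exists 0; exact: germ_cst. Qed.

Lemma ord_cst (c : R) x : ord (fun=> c) x = 0.
Proof. by rewrite ordE big1// => d _; exact/germ_slope/germ_cst. Qed.

Lemma plD f g : pl f -> pl g -> pl (fun x => f x + g x).
Proof.
move=> fpl gpl x d xd; have [k fk] := fpl _ _ xd; have [l gl] := gpl _ _ xd.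
by exists (k + l); exact: germD.
Qed.

Lemma plN f : pl f -> pl (fun x => - f x).
Proof.
by move=> fpl x d xd; have [k fk] := fpl _ _ xd; exists (- k); exact: germN.
Qed.

Lemma ordD f g x : pl f -> pl g -> ord (fun y => f y + g y) x = ord f x + ord g x.
Proof.
move=> fpl gpl; rewrite !ordE -big_split/=; apply: eq_bigr => d xd.
have [k fk] := fpl _ _ xd; have [l gl] := gpl _ _ xd.
by rewrite /sl (germ_slope fk) (germ_slope gl) (germ_slope (germD fk gl)).
Qed.

Lemma ordN f x : pl f -> ord (fun y => - f y) x = - ord f x.
Proof.
move=> fpl; rewrite !ordE -sumrN; apply: eq_bigr => d xd.
have [k fk] := fpl _ _ xd.
by rewrite /sl (germ_slope fk) (germ_slope (germN fk)).
Qed.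

Lemma pl_near f x : pl f -> forall eps, 0 < eps -> exists2 r, 0 < r &
  forall d h, dirs x d -> 0 <= h -> h < r -> `|f x - f (ray x d h)| < eps.
Proof.
move=> fpl eps eps0.
have [|t a b b0 ba Q|r r0 Hr] := @common_eps R _ (enum {: edge G * bool})
   (fun d r => dirs x d -> forall h, 0 <= h -> h < r -> `|f x - f (ray x d h)| < eps).
- move=> d _; have [xd|xd] := boolP (dirs x d); last by exists 1.
  have [r r0 Hr] := slP fpl xd; set k : R := (sl f x d)%:~R in Hr *.
  have k0 : 0 < `|k| + 1 by rewrite ltr_wpDl.
  exists (Num.min r (eps / (`|k| + 1))); first by rewrite lt_min r0 divr_gt0.
  move=> _ h h0; rewrite lt_min => /andP[hr]; rewrite ltr_pdivlMr// => hk.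
  rewrite Hr; last by rewrite h0 ltW.
  rewrite opprD addrA subrr add0r normrN normrM (ger0_norm h0).
  by apply: le_lt_trans hk; rewrite mulrC ler_wpM2l// lerDl.
- by move=> xd h h0 hb; apply: Q => //; apply: lt_le_trans ba.
- by exists r => // d h xd h0 hr; apply: Hr => //; rewrite mem_enum.
Qed.

Lemma pl_continuous f : pl f -> continuous f.
Proof.
move=> fpl x; apply/(@cvgrPdist_lt _ _ _ (nbhs x) (nbhs_filter x)) => eps eps0; apply/nbhs_radial.
by split; [rewrite subrr normr0|exact: pl_near].
Qed.

Lemma dirs_chart_fwd e t : 0 <= t < len e ->
  dirs (chart e t) (e, true) /\ pos (chart e t) (e, true) = t.
Proof.
move=> /andP[]; rewrite le_eqVlt => /predU1P[<- _|t0 tl].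
  by rewrite chart_le0// /dirs /pos/= eqxx.
by rewrite /dirs /pos pval_chart ?t0//= eqxx.
Qed.

Lemma dirs_chart_bwd e t : 0 < t <= len e ->
  dirs (chart e t) (e, false) /\ pos (chart e t) (e, false) = t.
Proof.
move=> /andP[t0]; rewrite le_eqVlt => /predU1P[->|tl].
  by rewrite chart_ge_len// /dirs /pos/= eqxx.
by rewrite /dirs /pos pval_chart ?t0//= eqxx.
Qed.

Lemma piecewise_linear_fwd e f t : piecewise_linear e f -> 0 <= t < len e ->
  exists k, germ (fun h => f (chart e (t + h))) k.
Proof.
move=> [s [[ps /eqP ls] Hs]] /andP[t0 tl].
have sn : s != [::] by apply/eqP => s0; move: ls (len_gt0 e); rewrite s0/= => ->; rewrite ltxx.
have hs : has (fun z => t < z) s.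
  apply/hasP; exists (len e) => //; rewrite -ls.
  by case: (s) sn => // a s' _; rewrite /= mem_last.
set i := find (fun z => t < z) s.
have is_ : (i < size s)%N by rewrite -has_find.
have /= [k Hk] := Hs i is_.
have ti : t < nth 0 s i by apply: (nth_find 0 hs).
have ai : nth 0 (0 :: s) i <= t.
  move: (@before_find _ 0 (fun z => t < z) s); rewrite -/i.
  by case: (i) => // j /(_ j (leqnn _)) /= /negbT; rewrite -leNgt.
exists k, (nth 0 s i - t); first by rewrite subr_gt0.
move=> h h0; rewrite addr0 (Hk (t + h)); last by lra.
by rewrite (Hk t); lra.
Qed.

Lemma piecewise_linear_bwd e f t : piecewise_linear e f -> 0 < t <= len e ->
  exists k, germ (fun h => f (chart e (t - h))) k.
Proof.
move=> [s [[ps /eqP ls] Hs]] /andP[t0 tl].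
have sn : s != [::] by apply/eqP => s0; move: ls (len_gt0 e); rewrite s0/= => ->; rewrite ltxx.
have hs : has (fun z => t <= z) s.
  apply/hasP; exists (len e) => //; rewrite -ls.
  by case: (s) sn => // a s' _; rewrite /= mem_last.
set i := find (fun z => t <= z) s.
have is_ : (i < size s)%N by rewrite -has_find.
have /= [k Hk] := Hs i is_.
have ti : t <= nth 0 s i by apply: (nth_find 0 hs).
have ai : nth 0 (0 :: s) i < t.
  move: (@before_find _ 0 (fun z => t <= z) s); rewrite -/i.
  by case: (i) => // j /(_ j (leqnn _)) /= /negbT; rewrite -ltNge.
exists (- k), (t - nth 0 (0 :: s) i); first by rewrite subr_gt0.
move=> h h0; rewrite subr0 (Hk (t - h)); last by lra.
by rewrite (Hk t) ?rmorphN/=; lra.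
Qed.

Lemma rational_function_pl f : rational_function f -> pl f.
Proof.
move=> [_ fpl] x [e b] xd; have := pos_itv xd; rewrite /ray/=.
by case: b xd => xd; [apply: piecewise_linear_fwd|apply: piecewise_linear_bwd].
Qed.

Lemma pl_rational_function f : pl f -> rational_function f.
Proof.
move=> fpl; split; first exact: pl_continuous.
move=> e.
pose lin a b := exists k, forall t, a <= t <= b ->
  f (chart e t) = f (chart e a) + k%:~R * (t - a).
pose P T := 0 <= T <= len e /\ exists s, itv_partition 0 T s /\
  forall i, (i < size s)%N -> lin (nth 0 (0 :: s) i) (nth 0 (0 :: s) i.+1).
have Pext T T' : P T -> T < T' -> T' <= len e -> lin T T' -> P T'.
  move=> [/andP[T0 Tl] [s [[ps /eqP ls] Hs]]] TT' T'l lT; split.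
    by rewrite T'l andbT (le_trans T0)// ltW.
  exists (rcons s T'); split.
    by split; rewrite ?last_rcons// rcons_path ps ls.
  move=> i; rewrite size_rcons ltnS leq_eqVlt => /predU1P[->|is_].
    rewrite -rcons_cons !nth_rcons/= ltnS leqnn ltnn eqxx.
    by rewrite -[size s]/(size (0 :: s)).-1 nth_last/= ls.
  by rewrite -rcons_cons !nth_rcons/= ltnS (ltnW is_) ltnS is_; exact: Hs.
have P0 : P 0.
  split; first by rewrite lexx ltW// len_gt0.
  by exists [::]; split => //; split => /=.
have hsP : has_sup P by split; [exists 0|exists (len e) => b [/andP[]]].
set c := sup P.
have c0 : 0 <= c by apply: (sup_ubound hsP.2).
have cl : c <= len e by apply: ge_sup; [exists 0|move=> ? [/andP[]]].
have Pc : P c.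
  have := c0; rewrite le_eqVlt => /predU1P[<-//|c0'].
  have cI : 0 < c <= len e by rewrite c0'.
  have [cd cp] := dirs_chart_bwd cI.
  have [k [eps e0]] := fpl _ _ cd; rewrite /ray cp/= => He.
  have [T PT cT] := sup_adherent e0 hsP.
  have Tc : T <= c by exact: (sup_ubound hsP.2).
  have := Tc; rewrite le_eqVlt => /predU1P[<-//|Tc'].
  apply: (Pext T) => //; exists (- k) => t tT.
  rewrite -/c in cT; have Hl z : T <= z <= c ->
      f (chart e z) = f (chart e (c - 0)) + k%:~R * (c - z).
    by move=> zT; have := He (c - z); rewrite subKr => -> //; lra.
  by rewrite (Hl t)// (Hl T) ?lexx// intrN; lra.
have -> : piecewise_linear e f <-> P (len e) by split => [|[]//]; split => //;
  rewrite lexx andbT ltW// len_gt0.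
suff -> : len e = c by [].
apply/eqP; rewrite eq_le cl andbT leNgt; apply/negP => cl'.
have cI : 0 <= c < len e by rewrite c0.
have [cd cp] := dirs_chart_fwd cI.
have [k [eps e0]] := fpl _ _ cd; rewrite /ray cp/= => He.
have : P (Num.min (len e) (c + eps)).
  apply: (Pext c) => //; first by rewrite lt_min cl' ltrDl.
    by rewrite ge_min lexx.
  exists k => t /andP[ct]; rewrite le_min => /andP[_ tc].
  by have := He (t - c); rewrite subrKC addr0 => ->//; lra.
move=> /(sup_ubound hsP.2); rewrite -/c ge_min; lra.
Qed.

Lemma ord_ray_eq0 f x d eps k : dirs x d -> eps <= room x d ->
  (forall h, 0 <= h <= eps -> f (ray x d h) = f x + k%:~R * h) ->
  forall h, 0 < h < eps -> ord f (ray x d h) = 0.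
Proof.
move=> xd er Hf h /andP[h0 he]; have hr : 0 < h < room x d by rewrite h0 (lt_le_trans he).
rewrite ord_ray// /sl (@germ_slope _ k) ?(@germ_slope _ (- k)) ?subrr//.
  exists h => // h' hh'; rewrite !ray_ray_opp// !Hf ?rmorphN/=; lra.
by exists (eps - h); rewrite ?subr_gt0// => h' hh'; rewrite !ray_ray// !Hf; lra.
Qed.

Lemma pl_div f : pl f -> exists D : divisor G, is_div f D.
Proof.
move=> fpl.
have [|||s Hs] := @uniform_bound R G (seq (gpoint G)) cat
  (fun s y => ord f y != 0 -> y \in s).
- by move=> s s' y H /H; rewrite mem_cat => ->.
- by move=> s s' y H /H; rewrite mem_cat orbC => ->.
- move=> x; exists [:: x]; apply/nbhs_radial; split; first by rewrite mem_head.
  have [|t a b b0 ba Q|r r0 Hr] := @common_eps R _ (enum {: edge G * bool})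
   (fun d r => dirs x d -> forall h, 0 <= h -> h < r -> ord f (ray x d h) != 0 ->
      ray x d h \in [:: x]).
  + move=> d _; have [xd|xd] := boolP (dirs x d); last by exists 1.
    have [r r0 Hr] := slP fpl xd.
    exists (Num.min r (room x d)); first by rewrite lt_min r0 room_gt0.
    move=> _ h; rewrite le_eqVlt => /predU1P[<- _ _|h0 hr].
      by rewrite ray0// mem_head.
    rewrite (@ord_ray_eq0 f x d (Num.min r (room x d)) (sl f x d)) ?eqxx ?h0//.
      by rewrite ge_min lexx orbT.
    by move=> h' /andP[h'0]; rewrite le_min => /andP[? _]; apply: Hr; rewrite h'0.
  + by move=> xd h h0 hb; apply: Q => //; apply: lt_le_trans ba.
  + by exists r => // d h xd h0 hr; apply: Hr => //; rewrite mem_enum.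
exists (\sum_(y <- undup s) << ord f y *g y >>) => x.
rewrite raddf_sum/=; under eq_bigr do rewrite coeffU.
have [xs|xs] := boolP (x \in undup s).
  rewrite (bigD1_seq x)/= ?undup_uniq// eqxx mulr1 big1 ?addr0// => y yx.
  by rewrite (negbTE yx) mulr0.
rewrite big_seq big1 => [|y ys].
  by apply/esym/eqP; apply: contraNT xs => /Hs; rewrite mem_undup.
by case: eqP ys xs => [->->//|]; rewrite mulr0.
Qed.

End PiecewiseLinear.

(** * Local convexity of the functions f with D + (f) >= 0 *)

Lemma chord_le (R : realType) (phi : R -> R) (a b : R) : a < b ->
  continuous phi ->
  (forall t, a < t < b -> exists2 eps, 0 < eps &
     forall h, 0 <= h <= eps -> 2 * phi t <= phi (t + h) + phi (t - h)) ->
  forall t, a <= t <= b -> phi t <= phi a + (t - a) / (b - a) * (phi b - phi a).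
Proof.
move=> ab cphi mid t tab.
pose m := (phi b - phi a) / (b - a).
have ba0 : 0 < b - a by rewrite subr_gt0.
have mE : m * (b - a) = phi b - phi a by rewrite divfK// gt_eqF.
have -> : (t - a) / (b - a) * (phi b - phi a) = m * (t - a).
  by rewrite /m mulrC mulrA [in RHS]mulrAC.
pose psi del s := phi s - phi a - m * (s - a) + del * ((s - a) * (s - b)).
have psi0 del : 0 < del -> psi del t <= 0.
  move=> del0.
  have cpsi : {within `[a, b], continuous (psi del)}.
    apply: continuous_subspaceT => s; rewrite /psi.
    have cB z : {for s, continuous (fun s : R => s - z)}.
      by apply: cvgB; [exact: cvg_id|exact: cvg_cst].
    apply: cvgD; last by apply: cvgM; [exact: cvg_cst|apply: cvgM; exact: cB].
    apply: cvgB; last by apply: cvgM; [exact: cvg_cst|exact: cB].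
    by apply: cvgB; [exact: cphi|exact: cvg_cst].
  have [c /[!in_itv]/= cab cmax] := EVT_max (ltW ab) cpsi.
  apply: (le_trans (cmax t _)); first by rewrite in_itv.
  have [ca|ca] := eqVneq c a.
    by rewrite /psi ca !subrr mul0r !mulr0 subr0 addr0.
  have [cb|cb] := eqVneq c b.
    by rewrite /psi cb mE !subrr !mulr0 addr0.
  have {ca}ac : a < c by rewrite lt_neqAle eq_sym ca; case/andP: cab.
  have {cb}cb : c < b by rewrite lt_neqAle cb; case/andP: cab.
  have [|eps e0 He] := mid c; first by rewrite ac.
  pose h := Num.min eps (Num.min (c - a) (b - c)).
  have h0 : 0 < h by rewrite !lt_min e0 !subr_gt0 ac.
  have he : h <= eps by rewrite ge_min lexx.
  have hca : h <= c - a by rewrite !ge_min lexx orbT.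
  have hcb : h <= b - c by rewrite !ge_min lexx !orbT.
  have := He h; rewrite he (ltW h0) => /(_ isT) Hh.
  have M1 := cmax (c + h); have M2 := cmax (c - h).
  rewrite in_itv/= in M1; rewrite in_itv/= in M2.
  have {}M1 : psi del (c + h) <= psi del c by apply: M1; lra.
  have {}M2 : psi del (c - h) <= psi del c by apply: M2; lra.
  have hh : 0 < del * (h * h) by rewrite !mulr_gt0.
  exfalso; rewrite /psi in M1 M2; nra.
rewrite -lerBlDl -subr_le0 leNgt; apply/negP => pos.
set w := phi t - phi a - m * (t - a) in pos.
have K0 : 0 <= (t - a) * (b - t) by apply: mulr_ge0; lra.
pose K := (t - a) * (b - t) + 1.
have KK : 0 < K by rewrite /K; lra.
have := psi0 (w / (2 * K)); rewrite divr_gt0// ?mulr_gt0// => /(_ isT).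
rewrite /psi -/w -[t - b]opprB mulrN mulrN.
have -> : w / (2 * K) * ((t - a) * (b - t)) = (w / 2) * (((t - a) * (b - t)) / K).
  by rewrite invfM; lra.
have : (t - a) * (b - t) / K <= 1 by rewrite ler_pdivrMr// /K; lra.
have : 0 <= (t - a) * (b - t) / K by rewrite divr_ge0// ltW.
move: (_ / K) => q q0 q1; nra.
Qed.

(* The integer subgradients of a convex function decrease as its argument     *)
(* tends to [0], hence are eventually constant.                               *)
Lemma subgradient_germ (R : realType) (phi : R -> R) (rho L : R) (N : nat) : 0 < rho ->
  (forall t, 0 < t < rho -> exists k : int, `|k|%R <= N%:Z /\
     forall s, 0 <= s <= rho -> phi t + k%:~R * (s - t) <= phi s) ->
  (forall h, 0 <= h <= rho -> `|phi h - phi 0| <= L * h) ->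
  exists k, germ phi k.
Proof.
move=> rho0 sg lip.
pose sub (k : int) t := forall s, 0 <= s <= rho -> phi t + k%:~R * (s - t) <= phi s.
pose P (n : nat) := `[< exists2 t, 0 < t < rho & sub (n%:Z - N%:Z) t >].
have toN (k : int) : `|k|%R <= N%:Z -> exists n : nat, k = n%:Z - N%:Z.
  move=> kN; have : 0 <= k + N%:Z by rewrite -lerBlDr sub0r; case/ler_normlP: kN; rewrite lerNl.
  by case E : (k + N%:Z) => [n|//] _; exists n; rewrite -E addrK.
have exP : exists n, P n.
  have [|k [/toN[n ->] Hk]] := sg (rho / 2); first by lra.
  by exists n; apply/asboolP; exists (rho / 2) => //; lra.
have [n /asboolP[t1 t1r Ht1] nmin] := ex_minnP exP.
set k := n%:Z - N%:Z in Ht1.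
have kt t : 0 < t < t1 -> sub k t.
  move=> tt1; have [|k' [/toN[n' k'E] Hk']] := sg t; first by lra.
  have nn' : (n <= n')%N.
    by apply: nmin; apply/asboolP; exists t; [lra|rewrite -k'E].
  have kk' : k <= k' by rewrite /k k'E lerD2r lez_nat.
  suff -> : k = k' by [].
  apply/eqP; rewrite eq_le kk' /=.
  have := Hk' t1; have := Ht1 t; rewrite -(@ler_int R).
  move: (k%:~R : R) (k'%:~R : R) => a b H1 H2.
  have {}H1 := H1 ltac:(lra); have {}H2 := H2 ltac:(lra).
  nra.
exists k, (t1 / 2); first by lra.
move=> h /andP[]; rewrite le_eqVlt => /predU1P[<- _|h0 ht]; first by rewrite mulr0 addr0.
apply/eqP; rewrite eq_sym -subr_eq0; apply/eqP/normr0_eq0.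
set w := `|_|; apply/eqP; rewrite eq_le normr_ge0 andbT.
apply/ler_addgt0Pr => eps e0; rewrite add0r.
pose kk : R := k%:~R.
have K0 : 0 < `|L| + `|kk| + 1 by rewrite ltr_wpDl// addr_ge0.
pose t := Num.min (eps / (`|L| + `|kk| + 1)) (t1 / 2).
have t0 : 0 < t by rewrite lt_min divr_gt0//; lra.
have tt1 : t <= t1 / 2 by rewrite ge_min lexx orbT.
have te : t * (`|L| + `|kk| + 1) <= eps by rewrite -ler_pdivlMr// ge_min lexx.
have A1 : phi h + kk * (t - h) <= phi t by apply: kt; lra.
have A2 : phi t + kk * (h - t) <= phi h by apply: kt; lra.
have A3 : `|phi t - phi 0| <= L * t by apply: lip; lra.
have -> : w = `|(phi t - phi 0) + - kk * t|.
  rewrite /w -/kk; have -> : phi h = phi t + kk * (h - t) by lra.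
  by rewrite -normrN; congr (`|_|); lra.
apply: le_trans (ler_normD _ _) _; rewrite normrM normrN (gtr0_norm t0).
apply: le_trans te; rewrite !mulrDr mulr1 (mulrC t `|kk|) (mulrC t).
have : L * t <= `|L| * t by rewrite ler_pM2r// ler_norm.
lra.
Qed.

Section Sections.
Context {R : realType} {G : metric_graph R}.
Implicit Types (x y v : gpoint G) (d : edge G * bool) (h t r : R).
Implicit Types (f g : gpoint G -> R) (D : divisor G).

Definition sect D : set (gpoint G -> R) :=
  [set f | pl f /\ forall x, 0 <= coeff x D + ord f x].

Definition star D x r : Prop := 0 < r /\ forall d, dirs x d ->
  r < room x d /\ forall h, 0 < h <= r -> coeff (ray x d h) D = 0.

Lemma ray_inj x d h t : dirs x d -> 0 < h < room x d -> 0 < t < room x d ->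
  ray x d h = ray x d t -> h = t.
Proof.
move=> xd hr tr E; have := pval_ray xd hr; rewrite E (pval_ray xd tr) => -[].
by case: d.2; lra.
Qed.

Lemma ray_neq x d h : dirs x d -> 0 < h < room x d -> ray x d h <> x.
Proof.
move=> xd hr E; have := pval_ray xd hr; rewrite E => px.
have : pos x d = if d.2 then pos x d + h else pos x d - h by rewrite {1}/pos px.
by case: d.2; lra.
Qed.

Lemma ray_disjoint x d d' h h' : dirs x d -> dirs x d' -> d != d' ->
  0 < h < room x d -> 0 < h' < room x d' -> ray x d h <> ray x d' h'.
Proof.
move=> xd xd' dd hr hr' E.
have := pval_ray xd hr; rewrite E (pval_ray xd' hr') => -[ee].
have d'E : d' = opp d.
  case: d d' dd ee {xd xd' hr hr' E} => e b [e' b'] /= + ee; subst e'.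
  by rewrite /opp/=; case: b; case: b'; rewrite ?eqxx.
subst d'; move: xd xd'; rewrite /dirs /pos; case Ex: (pval x) => [w|[e t]] xd xd'.
  suff [sE tE] : src d.1 = w /\ tgt d.1 = w by have := loopless d.1; rewrite sE tE eqxx.
  by move: xd xd' => /=; case: d.2 => /eqP -> /eqP ->.
by rewrite /=; case: d.2 => /=; lra.
Qed.

Lemma star_exists D x : exists r, star D x r.
Proof.
have [|d a b b0 ba Q|r r0 Hr] := @common_eps R _ (enum {: edge G * bool})
   (fun d r => dirs x d -> r < room x d /\ forall h, 0 < h <= r -> coeff (ray x d h) D = 0).
- move=> d _; have [xd|xd] := boolP (dirs x d); last by exists 1.
  have rm := room_gt0 xd.
  have [|z a b b0 ba Q|r r0 Hr] := @common_eps R _ (dom D)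
    (fun z r => forall h, 0 < h <= r -> h < room x d -> ray x d h != z).
  + move=> z _.
    have [[t [tr tz]]|nt] := pselect (exists t, 0 < t < room x d /\ ray x d t = z).
      exists (t / 2); first by lra.
      move=> h hr1 hr2; apply/eqP => hz.
      have : h = t by apply: (@ray_inj x d) => //; [lra|rewrite hz tz].
      lra.
    exists 1 => // h hr1 hr2; apply/eqP => hz; apply: nt; exists h; split=> //; lra.
  + by move=> h hb; apply: Q; lra.
  + exists (Num.min r (room x d / 2)); first by rewrite lt_min r0; lra.
    move=> _; split; first by rewrite gt_min; apply/orP; right; lra.
    move=> h /andP[h0]; rewrite le_min => /andP[hr hd].
    apply: coeff_outdom; apply/negP => /Hr; move=> /(_ h).
    by rewrite h0 hr eqxx => /(_ isT) H; suff : false by []; apply: H; lra.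
- move=> xd; have [H1 H2] := Q xd; split; first by lra.
  by move=> h hb; apply: H2; lra.
- by exists r; split => // d; apply: Hr; rewrite mem_enum.
Qed.

Lemma ray_continuous x d : continuous (ray x d).
Proof.
rewrite /ray => h.
apply: (@continuous_comp _ _ _ (fun h => if d.2 then pos x d + h else pos x d - h)
  (chart d.1)); last exact: chart_continuous.
case: d.2; [apply: cvgD|apply: cvgB]; by [exact: cvg_cst|exact: cvg_id].
Qed.

Lemma pl_ray_continuous f x d : pl f -> continuous (fun h => f (ray x d h)).
Proof.
move=> fpl h; apply: (@continuous_comp _ _ _ (ray x d) f); first exact: ray_continuous.
exact: pl_continuous.
Qed.

Section OneRay.
Variables (f : gpoint G -> R) (x : gpoint G) (d : edge G * bool) (r : R).
Hypotheses (fpl : pl f) (xd : dirs x d) (rr : r < room x d).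
Hypothesis ord_ge0 : forall h, 0 < h <= r -> 0 <= ord f (ray x d h).

Lemma ray_germs t : 0 < t <= r -> exists k l eps, [/\ 0 <= k + l, 0 < eps,
  forall h, 0 <= h <= eps -> f (ray x d (t + h)) = f (ray x d t) + k%:~R * h &
  forall h, 0 <= h <= eps -> f (ray x d (t - h)) = f (ray x d t) + l%:~R * h].
Proof.
move=> tr; have tm : 0 < t < room x d by move: rr tr; lra.
have yd : dirs (ray x d t) d by rewrite dirs_ray// eqxx.
have yo : dirs (ray x d t) (opp d) by rewrite dirs_ray// eqxx orbT.
have [a a0 Ha] := slP fpl yd; have [b b0 Hb] := slP fpl yo.
exists (sl f (ray x d t) d), (sl f (ray x d t) (opp d)), (Num.min a b); split.
- by rewrite -ord_ray//; exact: ord_ge0.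
- by rewrite lt_min a0.
- by move=> h /andP[h0]; rewrite le_min => /andP[ha hb]; rewrite -Ha ?h0// ray_ray.
- by move=> h /andP[h0]; rewrite le_min => /andP[ha hb]; rewrite -Hb ?h0// ray_ray_opp.
Qed.

Lemma ray_convex a b t : 0 <= a -> a < b -> b <= r -> a <= t <= b ->
  f (ray x d t) <= f (ray x d a) + (t - a) / (b - a) * (f (ray x d b) - f (ray x d a)).
Proof.
move=> a0 ab br; apply: (chord_le ab (pl_ray_continuous fpl)) => {}t tab.
have [|k [l [eps [kl e0 Hk Hl]]]] := @ray_germs t; first by lra.
exists eps => // h he; rewrite (Hk h he) (Hl h he).
have : 0 <= (k + l)%:~R * h by rewrite mulr_ge0 ?ler0z//; case/andP: he.
by rewrite intrD; lra.
Qed.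

Lemma ray_subgradient t : 0 < t < r -> exists k : int,
  forall s, 0 <= s <= r -> f (ray x d t) + k%:~R * (s - t) <= f (ray x d s).
Proof.
move=> tr; have [|k [l [eps [kl e0 Hk Hl]]]] := @ray_germs t; first by lra.
have {}kl : 0 <= (k%:~R + l%:~R) :> R by rewrite -intrD ler0z.
exists k => s sr; move: (k%:~R : R) (l%:~R : R) kl Hk Hl => kk ll kl Hk Hl.
have [st|ts|<-] := ltgtP s t; last by rewrite subrr mulr0 addr0.
- have := @ray_convex s t (t - Num.min eps (t - s)).
  set m := Num.min _ _.
  have m0 : 0 < m by rewrite lt_min e0 subr_gt0.
  have me : m <= eps by rewrite ge_min lexx.
  have ms : m <= t - s by rewrite ge_min lexx orbT.
  have ts0 : 0 < t - s by lra.
  rewrite Hl; last by lra.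
  have -> : (t - m - s) / (t - s) = 1 - m / (t - s).
    by rewrite -addrAC mulrBl divff// gt_eqF.
  move=> /(_ ltac:(lra) st ltac:(lra) ltac:(lra)).
  set q := m / (t - s); have q0 : 0 < q by rewrite divr_gt0.
  have -> : ll * m = ll * (t - s) * q.
    by rewrite -mulrA; congr (_ * _); rewrite /q mulrC divfK// gt_eqF.
  move: (f (ray x d s)) (f (ray x d t)) => B A H.
  have : ll * (t - s) <= B - A by rewrite -(ler_pM2r q0); lra.
  have : 0 <= (kk + ll) * (t - s) by rewrite mulr_ge0// ltW.
  lra.
- have := @ray_convex t s (t + Num.min eps (s - t)).
  set m := Num.min _ _.
  have m0 : 0 < m by rewrite lt_min e0 subr_gt0.
  have me : m <= eps by rewrite ge_min lexx.
  have ms : m <= s - t by rewrite ge_min lexx orbT.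
  have ts0 : 0 < s - t by lra.
  rewrite Hk; last by lra.
  rewrite [t + m - t]addrC addKr.
  move=> /(_ ltac:(lra) ts ltac:(lra) ltac:(lra)).
  set q := m / (s - t); have q0 : 0 < q by rewrite divr_gt0.
  have -> : kk * m = kk * (s - t) * q.
    by rewrite -mulrA; congr (_ * _); rewrite /q mulrC divfK// gt_eqF.
  move: (f (ray x d s)) (f (ray x d t)) => B A H.
  have : kk * (s - t) <= B - A by rewrite -(ler_pM2r q0); lra.
  lra.
Qed.

Lemma ray_slope_le s : 0 <= s <= r ->
  f x + (sl f x d)%:~R * s <= f (ray x d s).
Proof.
move=> /andP[]; rewrite le_eqVlt => /predU1P[<- _|s0 sr].
  by rewrite mulr0 addr0 ray0.
have [eps e0 He] := slP fpl xd.
have := @ray_convex 0 s (Num.min eps s).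
set m := Num.min _ _.
have m0 : 0 < m by rewrite lt_min e0.
have me : m <= eps by rewrite ge_min lexx.
have ms : m <= s by rewrite ge_min lexx orbT.
rewrite He; last by lra.
rewrite !subr0 ray0// => /(_ ltac:(lra) s0 sr ltac:(lra)).
set q := m / s; have q0 : 0 < q by rewrite divr_gt0.
move: (_%:~R : R) => k.
have -> : k * m = k * s * q.
    by rewrite -mulrA; congr (_ * _); rewrite /q mulrC divfK// gt_eqF.
move: (f x) (f (ray x d s)) => A B H.
have : k * s <= B - A by rewrite -(ler_pM2r q0); lra.
lra.
Qed.

End OneRay.

Section Star.
Variables (D : divisor G) (f : gpoint G -> R) (x : gpoint G) (r : R).
Hypotheses (fD : sect D f) (xr : star D x r).

Let r0 : 0 < r. Proof. by case: xr. Qed.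

Lemma sect_ord_ge0 d h : dirs x d -> 0 < h <= r -> 0 <= ord f (ray x d h).
Proof.
by move=> xd hr; have := fD.2 (ray x d h); have [_ /(_ _ hr) ->] := xr.2 _ xd; rewrite add0r.
Qed.

Lemma sect_chord d h : dirs x d -> 0 <= h <= r ->
  f (ray x d h) <= f x + h / r * (f (ray x d r) - f x).
Proof.
move=> xd hr.
have := @ray_convex f x d r fD.1 xd (xr.2 _ xd).1 (fun h => @sect_ord_ge0 d h xd) 0 r h.
by rewrite !subr0 ray0//; apply.
Qed.

Lemma sect_star_sum h : 0 <= h <= r ->
  - (coeff x D)%:~R * h <= \sum_(d | dirs x d) (f (ray x d h) - f x).
Proof.
move=> hr; apply: (@le_trans _ _ (\sum_(d | dirs x d) (sl f x d)%:~R * h)); last first.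
  apply: ler_sum => d xd; rewrite lerBrDl.
  exact: (ray_slope_le fD.1 xd (xr.2 _ xd).1 (fun h => @sect_ord_ge0 d h xd)).
rewrite -mulr_suml -rmorph_sum/= -ordE ler_wpM2r//; first by case/andP: hr.
by rewrite -intrN ler_int -subr_ge0 opprK addrC; exact: fD.2.
Qed.

Lemma sect_subgradient d t : dirs x d -> 0 < t < r -> exists k : int,
  forall s, 0 <= s <= r -> f (ray x d t) + k%:~R * (s - t) <= f (ray x d s).
Proof.
move=> xd.
exact: (ray_subgradient fD.1 xd (xr.2 _ xd).1 (fun h => @sect_ord_ge0 d h xd)).
Qed.

End Star.
End Sections.

(** * The largest f with D + (f) >= 0 and f(v) = 0 *)

Section MaximalSection.
Context {R : realType} {G : metric_graph R}.
Implicit Types (x y v : gpoint G) (d : edge G * bool) (h t r M C : R).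
Implicit Types (f g : gpoint G -> R) (D : divisor G).

Let ndirs : R := #|{: edge G * bool}|%:R.

Lemma sum_dirs_le (P : pred (edge G * bool)) (F : edge G * bool -> R) C :
  0 <= C -> (forall d, P d -> F d <= C) -> \sum_(d | P d) F d <= ndirs * C.
Proof.
move=> C0 HF; apply: (@le_trans _ _ (\sum_(d | P d) C)); first exact: ler_sum.
rewrite sumr_const -mulr_natl ler_wpM2r// ler_nat; exact: max_card.
Qed.

(* The summand 1 keeps both sides positive, so that the constants multiply    *)
(* along a chain of points even where f attains M.                            *)
Definition harnack D x y C := forall f M, sect D f -> (forall z, f z <= M) ->
  M - f y + 1 <= C * (M - f x + 1) /\ M - f x + 1 <= C * (M - f y + 1).

Lemma harnackS D x y C C' : C <= C' -> harnack D x y C -> harnack D x y C'.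
Proof.
move=> CC' H f M fD fM; have [H1 H2] := H f M fD fM.
by split; [apply: (le_trans H1)|apply: (le_trans H2)]; rewrite ler_wpM2r//;
  rewrite addr_ge0// subr_ge0.
Qed.

Lemma harnack_trans D x y z C C' : 0 <= C -> 0 <= C' ->
  harnack D x y C -> harnack D y z C' -> harnack D x z (C * C').
Proof.
move=> C0 C'0 H H' f M fD fM; have [H1 H2] := H f M fD fM.
have [H'1 H'2] := H' f M fD fM; split.
  by apply: (le_trans H'1); rewrite (mulrC C) -mulrA ler_wpM2l.
by apply: (le_trans H2); rewrite -mulrA ler_wpM2l.
Qed.

Lemma harnackC D x y C : harnack D x y C -> harnack D y x C.
Proof. by move=> H f M fD fM; have [] := H f M fD fM. Qed.

Lemma sect_ray_lower D x r d h f M : star D x r -> dirs x d -> 0 <= h <= r ->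
  sect D f -> (forall d', dirs x d' -> f (ray x d' h) <= M) -> f x <= M ->
  f x - `|(coeff x D)%:~R| * h - ndirs * (M - f x) <= f (ray x d h).
Proof.
move=> xr xd hr fD fM xM.
have := sect_star_sum fD xr hr; rewrite (bigD1 d)//=; set S := \sum_(_ | _) _ => H1.
have H2 : S <= ndirs * (M - f x).
  apply: sum_dirs_le; first by rewrite subr_ge0.
  by move=> d' /andP[xd' _]; rewrite lerB// fM.
have : (coeff x D)%:~R * h <= `|(coeff x D)%:~R| * h.
  by rewrite ler_wpM2r ?ler_norm//; case/andP: hr.
lra.
Qed.

Lemma harnack_near D x : exists2 C, 0 <= C & \forall y \near x, harnack D x y C.
Proof.
have [r xr] := star_exists D x; have r0 : 0 < r by case: xr.
set a : R := `|(coeff x D)%:~R|.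
have a0 : 0 <= a := normr_ge0 _.
have n0 : 0 <= ndirs by rewrite ler0n.
exists (2 + a * r + ndirs); first by rewrite !addr_ge0// mulr_ge0// ltW.
apply/nbhs_radial; split.
  move=> f M fD fM.
  have H0 : 0 <= M - f x by rewrite subr_ge0.
  have ar : 0 <= a * r by rewrite mulr_ge0// ltW.
  by split; rewrite ler_peMl//; lra.
exists (r / 2); first by rewrite divr_gt0.
move=> d h xd h0 hr f M fD fM.
have hr' : 0 <= h <= r by lra.
have H0 : 0 <= M - f x by rewrite subr_ge0.
have H1 : 0 <= M - f (ray x d h) by rewrite subr_ge0.
have ar : 0 <= a * r by rewrite mulr_ge0// ltW.
have A1 := sect_ray_lower xr xd hr' fD (fun d' _ => fM (ray x d' h)) (fM x).
have A2 := sect_chord fD xr xd hr'.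
have ah : a * h <= a * r by rewrite ler_wpM2l//; lra.
have arH : 0 <= a * r * (M - f x) by rewrite mulr_ge0.
have nH : 0 <= ndirs * (M - f (ray x d h)) by rewrite mulr_ge0.
have arH1 : 0 <= a * r * (M - f (ray x d h)) by rewrite mulr_ge0.
rewrite -/a in A1; split; first by lra.
have q0 : 0 <= h / r by rewrite divr_ge0// ltW.
have q1 : h / r <= 1 / 2 by rewrite ler_pdivrMr//; lra.
have A3 : h / r * (f (ray x d r) - f x) <= 1 / 2 * (M - f x).
  apply: (@le_trans _ _ (h / r * (M - f x))); first by rewrite ler_wpM2l// lerB.
  by rewrite ler_wpM2r.
lra.
Qed.

Lemma osc_bound D : exists2 C, 0 <= C &
  forall f, sect D f -> forall x y, f x <= f y + C.
Proof.
have v : gpoint G by have /card_gt0P/sigW[v _] := vert_inhabited G; exact: vpoint v.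
pose S := [set y | exists2 C, 0 <= C & harnack D v y C].
have S1 x y C : 0 <= C -> harnack D x y C -> S x -> S y.
  move=> C0 H [C' C'0 H']; exists (C' * C); first exact: mulr_ge0.
  exact: harnack_trans H' H.
have ST y : S y.
  apply: (@connected_gpoint _ _ S _ _ v).
  - rewrite openE => x Sx; rewrite /interior; have [C C0] := harnack_near D x.
    by apply: filterS => z xz; exact: S1 xz Sx.
  - rewrite openE => x Sx; rewrite /interior; have [C C0] := harnack_near D x.
    by apply: filterS => z xz Sz; apply/Sx/(S1 z _ C) => //; exact: harnackC.
  - exists 1 => // f M fD fM; rewrite mul1r; split=> //.
have [|||C HC] := @uniform_bound R G R Num.max (fun C y => 0 <= C /\ harnack D v y C).
- move=> c c' y [c0 H]; split; first by rewrite le_max c0.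
  by apply: harnackS H; rewrite le_max lexx.
- move=> c c' y [c0 H]; split; first by rewrite le_max c0 orbT.
  by apply: harnackS H; rewrite le_max lexx orbT.
- move=> x; have [C' C'0 H'] := ST x; have [C C0 xC] := harnack_near D x.
  exists (C' * C); apply: filterS xC => z xz; split; first exact: mulr_ge0.
  exact: harnack_trans H' xz.
exists (C * C); first by case: (HC v) => C0 _; exact: mulr_ge0.
move=> f fD x y.
have [||z _ zmax] := @compact_EVT_max (gpoint G) R f setT _ compact_gpoint.
- by exists v.
- exact/continuous_subspaceT/pl_continuous/fD.1.
have fM w : f w <= f z by apply: zmax; rewrite inE.
have [C0 Hy] := HC y; have [_ Hz] := HC z.
have [Hy1 _] := Hy f (f z) fD fM; have [_ Hz2] := Hz f (f z) fD fM.
rewrite subrr add0r mulr1 in Hz2.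
have : C * (f z - f v + 1) <= C * C by rewrite ler_wpM2l.
have := fM x; lra.
Qed.

Lemma star_lip D x r : star D x r -> exists2 L, 0 <= L &
  forall f d h, sect D f -> dirs x d -> 0 <= h <= r -> `|f (ray x d h) - f x| <= L * h.
Proof.
move=> xr; have r0 : 0 < r by case: xr.
have [C C0 HC] := osc_bound D.
set a : R := `|(coeff x D)%:~R|.
have a0 : 0 <= a := normr_ge0 _.
have Cr : 0 <= C / r by rewrite divr_ge0// ltW.
have n0 : 0 <= ndirs by rewrite ler0n.
have nC : 0 <= ndirs * (C / r) by rewrite mulr_ge0.
exists (a + (ndirs + 1) * (C / r)).
  by rewrite addr_ge0// mulr_ge0// addr_ge0//.
move=> f d h fD xd hr; have h0 : 0 <= h by case/andP: hr.
have up d' : dirs x d' -> f (ray x d' h) <= f x + C / r * h.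
  move=> xd'; apply: (le_trans (sect_chord fD xr xd' hr)); rewrite lerD2l.
  rewrite (mulrC _ h) (mulrCA h) (mulrC C) ler_wpM2l ?divr_ge0 ?(ltW r0)//.
  by rewrite lerBlDl; apply: HC.
have Crh : 0 <= C / r * h by rewrite mulr_ge0.
have nCh : 0 <= ndirs * (C / r) * h by rewrite mulr_ge0.
have ah : 0 <= a * h by rewrite mulr_ge0.
have fx : f x <= f x + C / r * h by rewrite lerDl.
have := sect_ray_lower xr xd hr fD up fx; have := up _ xd.
rewrite -/a ler_norml => H1 H2; lra.
Qed.

Lemma maximal_sect D v : sect D !=set0 -> exists f0, [/\ sect D f0, f0 v = 0 &
  forall f, sect D f -> f v = 0 -> forall x, f x <= f0 x].
Proof.
move=> [f1 f1D].
pose F := [set f | sect D f /\ f v = 0].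
have F1 : F (fun x => f1 x + - f1 v).
  split; last by rewrite subrr.
  split; first exact: plD f1D.1 (pl_cst _).
  move=> x; rewrite ordD; [|exact: f1D.1|exact: pl_cst].
  by rewrite ord_cst addr0; exact: f1D.2.
have [C C0 HC] := osc_bound D.
pose V x := [set f x | f in F].
have hV x : has_sup (V x).
  split; first by exists (f1 x - f1 v); exists (fun x => f1 x + - f1 v).
  by exists C => _ [f [fD fv] <-]; have := HC f fD x v; rewrite fv add0r.
pose f0 x := sup (V x).
have f0_ge f x : F f -> f x <= f0 x by move=> Ff; apply: (sup_ubound (hV x).2); exists f.
have f0_adh x eps : 0 < eps -> exists2 f, F f & f0 x - eps < f x.
  by move=> e0; have [_ [f Ff <-] H] := sup_adherent e0 (hV x); exists f.
have f0_le x c : (forall f, F f -> f x <= c) -> f0 x <= c.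
  by move=> H; apply: ge_sup; [exact: (hV x).1|move=> _ [f Ff <-]; exact: H].
exists f0; split; last by move=> f fD fv x; exact: f0_ge.
- have f0pl : pl f0.
    move=> x d xd.
    have [r xr] := star_exists D x; have r0 : 0 < r by case: xr.
    have [L L0 HL] := star_lip xr.
    have lip0 h : 0 <= h <= r -> `|f0 (ray x d h) - f0 x| <= L * h.
      move=> hr; rewrite ler_norml; apply/andP; split.
        rewrite lerBrDl; suff : f0 x <= f0 (ray x d h) + L * h by lra.
        apply: f0_le => f Ff; have := HL f d h Ff.1 xd hr; have := f0_ge f (ray x d h) Ff.
        by rewrite ler_norml; lra.
      rewrite lerBlDr; apply: f0_le => f Ff; have := HL f d h Ff.1 xd hr.
      by have := f0_ge f x Ff; rewrite ler_norml; lra.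
    pose N := Num.bound (L + 2 * C / r).
    have LN : L + 2 * C / r < N%:R.
      by apply: archi_boundP; rewrite addr_ge0// divr_ge0 ?(ltW r0)// mulr_ge0.
    have Cr0 : 0 <= 2 * C / r by rewrite divr_ge0 ?(ltW r0)// mulr_ge0.
    apply: (@subgradient_germ _ _ (r / 2) L N); first by lra.
      move=> t tr; apply: contrapT => nk.
      pose ks := [seq (n%:Z - N%:Z)%R | n <- iota 0 (N + N).+1].
      have ksP k : k \in ks <-> `|k|%R <= N%:Z.
        split=> [/mapP[n]|kN]; first by rewrite mem_iota => nN ->; lia.
        by apply/mapP; exists (absz (k + N%:Z)); rewrite ?mem_iota; lia.
      have [|k a b b0 ba [s sr Hs]|eps e0 He] := @common_eps R _ ks (fun k eps =>
        exists2 s, 0 <= s <= r / 2 &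
          f0 (ray x d s) + eps <= f0 (ray x d t) + k%:~R * (s - t)).
      + move=> k /ksP kN; apply: contrapT => ne; apply: nk; exists k; split => // s sr.
        rewrite leNgt; apply/negP => lt_s; apply: ne.
        exists (f0 (ray x d t) + k%:~R * (s - t) - f0 (ray x d s)); first by rewrite subr_gt0.
        by exists s => //; rewrite subrKC.
      + by exists s => //; lra.
      have [f Ff ft] := f0_adh (ray x d t) _ e0.
      have [|k Hk] := sect_subgradient Ff.1 xr xd (t := t); first by lra.
      have kN : k \in ks.
        apply/ksP; rewrite -(@ler_int R) intr_norm ler_norml.
        have H0 := Hk 0; rewrite ray0// in H0; have {H0} := H0 ltac:(lra).
        have {Hk} := Hk r ltac:(lra).
        have := HL f d t Ff.1 xd ltac:(lra); have := HC f Ff.1 (ray x d r) (ray x d t).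
        rewrite ler_norml; move: (f _) (f _) (f _) (k%:~R : R) LN => A B X k' LN P1 P2 P3 P4.
        have tL : - (k' + L) * t <= 0 by lra.
        have kL : 0 <= k' + L by rewrite -oppr_le0 -(pmulr_lle0 _ (x := t))//; lra.
        have kC : k' * (r - t) <= C by lra.
        have k'C : k' <= 2 * C / r.
          rewrite ler_pdivlMr//; have [k0|k0] := leP 0 k'; last by nra.
          have : k' * (r / 2) <= k' * (r - t) by rewrite ler_wpM2l//; lra.
          lra.
        have -> : (N%:Z)%:~R = N%:R :> R by [].
        lra.
      have [s sr Hs] := He k kN.
      have := Hk s ltac:(lra); have := f0_ge f (ray x d s) Ff; lra.
    by move=> h hr; rewrite (ray0 xd); apply: lip0; lra.
  split=> // x.
  have [r xr] := star_exists D x; have r0 : 0 < r by case: xr.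
  have sum0 h : 0 <= h <= r ->
      - (coeff x D)%:~R * h <= \sum_(d | dirs x d) (f0 (ray x d h) - f0 x).
    move=> hr; apply/ler_addgt0Pr => eps e0.
    have n0 : 0 < ndirs + 1 by rewrite ltr_wpDl// ler0n.
    have [f Ff fx] := f0_adh x (eps / (ndirs + 1)) (divr_gt0 e0 n0).
    apply: (le_trans (sect_star_sum Ff.1 xr hr)).
    rewrite -lerBlDl -sumrB.
    apply: (@le_trans _ _ (ndirs * (eps / (ndirs + 1)))).
      apply: sum_dirs_le; first by rewrite divr_ge0// ltW.
      by move=> d _; have := f0_ge f (ray x d h) Ff; lra.
    by rewrite mulrCA ler_piMr ?(ltW e0)// ler_pdivrMr// mul1r lerDl.
  have [eps e0 He] := pl_star x f0pl.
  pose h := Num.min r eps; have h0 : 0 < h by rewrite lt_min r0.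
  have := sum0 h; rewrite ge_min lexx (ltW h0) => /(_ isT).
  rewrite (eq_bigr (fun d => (sl f0 x d)%:~R * h)); last first.
    move=> d xd; rewrite He//; first by rewrite addrAC subrr add0r.
    by rewrite (ltW h0) ge_min lexx orbT.
  rewrite -mulr_suml -rmorph_sum/= -ordE ler_pM2r// -intrN ler_int.
  by rewrite -subr_ge0 opprK addrC.
- apply/eqP; rewrite eq_le; apply/andP; split.
    by apply: f0_le => f [_ ->].
  by have := f0_ge _ v F1; rewrite subrr.
Qed.

End MaximalSection.

(** * Firing a closed set *)

Lemma germ_local (R : realType) (u w : R -> R) (k : int) (eps : R) : 0 < eps ->
  (forall h, 0 <= h < eps -> u h = w h) -> germ w k -> germ u k.
Proof.
move=> e0 uw [a a0 Ha]; exists (Num.min a (eps / 2)); first by rewrite lt_min a0; lra.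
move=> h /andP[h0]; rewrite le_min => /andP[ha he].
by rewrite (uw h) ?(uw 0) ?(Ha h) ?h0//; lra.
Qed.

Lemma germ_tent_fwd (R : realType) (c : R) :
  germ (fun k => Num.max 0 (c - k)) (if 0 < c then -1 else 0).
Proof.
case: ifPn => [c0|]; last rewrite -leNgt => c0.
  by exists c => // h hc; rewrite !max_r ?intrN; lra.
by exists 1 => // h hc; rewrite !max_l; lra.
Qed.

Lemma germ_tent_bwd (R : realType) (c : R) :
  germ (fun k => Num.max 0 (c + k)) (if 0 <= c then 1 else 0).
Proof.
case: ifPn => [c0|]; last rewrite -ltNge => c0.
  by exists 1 => // h hc; rewrite !max_r; lra.
by exists (- c) => [|h hc]; rewrite ?oppr_gt0// !max_l; lra.
Qed.

Section Firing.
Context {R : realType} {G : metric_graph R}.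
Implicit Types (x y : gpoint G) (d : edge G * bool) (h k : R) (X : set (gpoint G)).

Definition outward X x d : Prop := [/\ X x, dirs x d &
  exists2 eps, 0 < eps & forall h, 0 < h <= eps -> ~ X (ray x d h)].

Lemma eq_ray_dirs x d h x' d' h' : dirs x d -> 0 < h < room x d ->
  dirs x' d' -> 0 < h' < room x' d' -> ray x d h = ray x' d' h' ->
  d' = d \/ d' = opp d.
Proof.
move=> xd hr xd' hr' E; have : dirs (ray x d h) d' by rewrite E dirs_ray// eqxx.
by rewrite dirs_ray// => /orP[]/eqP; [left|right].
Qed.

Lemma eq_ray_same x x' d h h' k : dirs x d -> 0 < h < room x d ->
  dirs x' d -> 0 < h' < room x' d -> ray x d h = ray x' d h' ->
  ray x d (h - k) = ray x' d (h' - k).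
Proof. by move=> xd hr xd' hr' E; rewrite -!ray_ray_opp// E. Qed.

Lemma eq_ray_opp x x' d h h' k : dirs x d -> 0 < h < room x d ->
  dirs x' (opp d) -> 0 < h' < room x' (opp d) -> ray x d h = ray x' (opp d) h' ->
  ray x d (h - k) = ray x' (opp d) (h' + k).
Proof. by move=> xd hr xd' hr' E; rewrite -ray_ray_opp// -ray_ray// E. Qed.

Variables (D : divisor G) (X : set (gpoint G)).
Hypothesis Deff : effective D.
Hypothesis Xclosed : closed X.
Hypothesis Xinward : forall x d, X x -> dirs x d -> ~ outward X x d ->
  exists2 eps, 0 < eps & forall h, 0 < h <= eps -> X (ray x d h).
Hypothesis Xboundary : forall x d, outward X x d -> coeff x D != 0.
Hypothesis Xout1 : forall x d d', outward X x d -> outward X x d' -> d = d'.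

Let collar (eps : R) := 0 < eps /\ forall x d, outward X x d ->
  4 * eps < room x d /\ forall h, 0 < h <= 4 * eps -> ~ X (ray x d h).

Let collar_exists : exists eps, collar eps.
Proof.
have [|x a b b0 ba Q d /Q[H1 H2]|eps e0 He] := @common_eps R _ (dom D)
  (fun x eps => forall d, outward X x d ->
  4 * eps < room x d /\ forall h, 0 < h <= 4 * eps -> ~ X (ray x d h)).
- move=> x _.
  have [|d a b b0 ba Q /Q[H1 H2]|eps e0 He] := @common_eps R _ (enum {: edge G * bool})
    (fun d eps => outward X x d ->
    4 * eps < room x d /\ forall h, 0 < h <= 4 * eps -> ~ X (ray x d h)).
  + move=> d _; have [[Xx xd [eps e0 He]]|no] := pselect (outward X x d); last by exists 1.
    exists (Num.min eps (room x d) / 8).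
      by rewrite divr_gt0// lt_min e0 room_gt0.
    have m1 : Num.min eps (room x d) <= eps by rewrite ge_min lexx.
    have m2 : Num.min eps (room x d) <= room x d by rewrite ge_min lexx orbT.
    have rm := room_gt0 xd.
    move=> _; split; first by lra.
    by move=> h hr; apply: He; lra.
  + by split; [lra|move=> h hr; apply: H2; lra].
  + by exists eps => // d; apply: He; rewrite mem_enum.
- by split; [lra|move=> h hr; apply: H2; lra].
- exists eps; split=> // x d xd; apply: (He x _ d) => //.
  by rewrite mem_dom; exact: Xboundary xd.
Qed.

Section Tent.
Variable eps : R.
Hypothesis Heps : collar eps.

Let e0 : 0 < eps. Proof. by case: Heps. Qed.

Let tube y h := exists x d, [/\ outward X x d, 0 < h, h < 2 * eps & y = ray x d h].

Let tube_room x d h : outward X x d -> 0 < h -> h < 2 * eps -> 0 < h < room x d.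
Proof. by move=> /(Heps.2)[]; lra. Qed.

Let tubeNX y h : tube y h -> ~ X y.
Proof.
by move=> [x [d [xd h0 h2 ->]]]; apply: (Heps.2 x d xd).2; move: e0; lra.
Qed.

Let tube_le y h h' : tube y h -> tube y h' -> h <= h'.
Proof.
move=> [x [d [xo h0 h2 yE]]] [x' [d' [xo' h'0 h'2 yE']]].
have E : ray x d h = ray x' d' h' by rewrite -yE.
have [Xx xd _] := xo; have [Xx' xd' _] := xo'.
have hr := tube_room xo h0 h2; have hr' := tube_room xo' h'0 h'2.
have [dd|dd] := eq_ray_dirs xd hr xd' hr' E; subst d'.
  rewrite leNgt; apply/negP => lt_h.
  have := eq_ray_same h' xd hr xd' hr' E; rewrite subrr ray0// => x'E.
  by apply: ((Heps.2 x d xo).2 (h - h')); [lra|rewrite x'E].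
have := eq_ray_opp h xd hr xd' hr' E; rewrite subrr ray0// => xE.
by exfalso; apply: ((Heps.2 x' _ xo').2 (h' + h)); [lra|rewrite -xE].
Qed.

(* [max 0 (eps - dist y X)]; the distance is read off the outward ray from X  *)
(* through y, which [tube_le] shows to be unambiguous.                        *)
Let fire y : R := if `[< X y >] then eps
  else Num.max 0 (eps - xget (2 * eps) [set h | tube y h]).

Let fireX y : X y -> fire y = eps.
Proof. by move=> Xy; rewrite /fire asboolT. Qed.

Let fire_tube y h : tube y h -> fire y = Num.max 0 (eps - h).
Proof.
move=> yh; rewrite /fire asboolF; last exact: tubeNX yh.
rewrite (@xget_unique _ _ _ h)// => h' yh'; apply/eqP.
by rewrite eq_le !(tube_le yh yh', tube_le yh' yh).
Qed.

Let fire0 y : ~ X y -> (forall h, ~ tube y h) -> fire y = 0.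
Proof.
move=> Xy Ty; rewrite /fire asboolF// xgetPN//.
by rewrite max_l//; move: e0; lra.
Qed.

Let fire_outward x d h : outward X x d -> 0 <= h < 2 * eps ->
  fire (ray x d h) = Num.max 0 (eps - h).
Proof.
move=> xo /andP[]; rewrite le_eqVlt => /predU1P[<- _|h0 h2].
  by have [Xx xd _] := xo; rewrite ray0// fireX// subr0 max_r// ltW.
by apply: fire_tube; exists x, d.
Qed.

Let germ_outward x d : outward X x d -> germ (fun h => fire (ray x d h)) (-1).
Proof.
move=> xo; have := germ_tent_fwd eps; rewrite e0.
by apply: (@germ_local _ _ _ _ (2 * eps)) => [|h]; [rewrite mulr_gt0|exact: fire_outward].
Qed.

Let germ_inward x d : X x -> dirs x d -> ~ outward X x d ->
  germ (fun h => fire (ray x d h)) 0.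
Proof.
move=> Xx xd no; have [a a0 Ha] := Xinward Xx xd no.
apply: (germ_local a0 _ (@germ_cst R eps)) => h /andP[].
rewrite le_eqVlt => /predU1P[<- _|h0 ha]; first by rewrite ray0 ?fireX.
by rewrite fireX//; apply: Ha; rewrite h0 ltW.
Qed.

Let germ_tube_fwd x d h : outward X x d -> 0 < h -> h < 2 * eps ->
  germ (fun k => fire (ray (ray x d h) d k)) (if 0 < eps - h then -1 else 0).
Proof.
move=> xo h0 h2; have hr := tube_room xo h0 h2; have [_ xd _] := xo.
apply: (@germ_local _ _ _ _ (2 * eps - h) _ _ (germ_tent_fwd (eps - h))).
  by rewrite subr_gt0.
move=> k hk; rewrite ray_ray// (_ : eps - h - k = eps - (h + k)); last by lra.
by apply: fire_outward xo _; lra.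
Qed.

Let germ_tube_bwd x d h : outward X x d -> 0 < h -> h < 2 * eps ->
  germ (fun k => fire (ray (ray x d h) (opp d) k)) (if 0 <= eps - h then 1 else 0).
Proof.
move=> xo h0 h2; have hr := tube_room xo h0 h2; have [_ xd _] := xo.
apply: (@germ_local _ _ _ _ h h0 _ (germ_tent_bwd (eps - h))) => k hk.
rewrite ray_ray_opp// (_ : eps - h + k = eps - (h - k)); last by lra.
by apply: fire_outward xo _; lra.
Qed.

Let germ_away y d : ~ X y -> (forall h, ~ tube y h) -> dirs y d ->
  germ (fun k => fire (ray y d k)) 0.
Proof.
move=> Xy Ty yd.
have : nbhs y (~` X) by apply: open_nbhs_nbhs; split => //; exact: closed_openC.
move=> /nbhs_radial[_ [a a0 Ha]].
have rm := room_gt0 yd.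
pose b := Num.min a (Num.min eps (room y d)).
have b0 : 0 < b by rewrite !lt_min a0 e0.
have ba : b <= a by rewrite ge_min lexx.
have be : b <= eps by rewrite !ge_min lexx orbT.
have br : b <= room y d by rewrite !ge_min lexx !orbT.
apply: (germ_local b0 _ (@germ_cst R 0)) => k /andP[].
rewrite le_eqVlt => /predU1P[<- _|k0 kb]; first by rewrite ray0 ?fire0.
have XNk : ~ X (ray y d k) by apply: Ha => //; lra.
have [[h Th]|nT] := pselect (exists h, tube (ray y d k) h); last first.
  by apply: fire0 => // h Th; apply: nT; exists h.
rewrite (fire_tube Th); apply: max_l.
have [x [d' [xo h0 h2 E]]] := Th; have [Xx xd _] := xo.
have kr : 0 < k < room y d by lra.
have hr := tube_room xo h0 h2.
have [dd|dd] := eq_ray_dirs yd kr xd hr E; subst d'.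
- have [kh|hk|kh] := ltgtP k h.
  + have := eq_ray_same k yd kr xd hr E; rewrite subrr ray0// => yE.
    by exfalso; apply: (Ty (h - k)); exists x, d; split => //; lra.
  + have := eq_ray_same h yd kr xd hr E; rewrite subrr ray0// => xE.
    by exfalso; apply: (Ha d (k - h)) => //; [lra|lra|rewrite xE].
  + have := eq_ray_same k yd kr xd hr E; rewrite kh !subrr !ray0// => yE.
    by exfalso; apply: Xy; rewrite yE.
- have := eq_ray_opp k yd kr xd hr E; rewrite subrr ray0// => yE.
  have [hk|hk] := ltP (h + k) (2 * eps); last by lra.
  by exfalso; apply: (Ty (h + k)); exists x, (opp d); split => //; lra.
Qed.

Let cases y : X y \/ (exists x d h, [/\ outward X x d, 0 < h, h < 2 * eps & y = ray x d h])
  \/ (~ X y /\ forall h, ~ tube y h).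
Proof.
have [Xy|Xy] := pselect (X y); first by left.
have [[h [x [d H]]]|nT] := pselect (exists h, tube y h).
  by right; left; exists x, d, h.
by right; right; split => // h Th; apply: nT; exists h.
Qed.

Let fire_pl : pl fire.
Proof.
move=> y d yd; have [Xy|[[x [d' [h [xo h0 h2 E]]]]|[Xy Ty]]] := cases y.
- have [yo|yo] := pselect (outward X y d); first by exists (-1); exact: germ_outward.
  by exists 0; exact: germ_inward.
- have [_ xd _] := xo; have hr := tube_room xo h0 h2.
  move: yd; rewrite E dirs_ray// => /orP[]/eqP ->.
    by eexists; exact: germ_tube_fwd.
  by eexists; exact: germ_tube_bwd.
- by exists 0; exact: germ_away.
Qed.

Let fire_ord y : 0 <= coeff y D + ord fire y.
Proof.
have [Xy|[[x [d [h [xo h0 h2 E]]]]|[Xy Ty]]] := cases y.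
- have [[d yo]|no] := pselect (exists d, outward X y d); last first.
    rewrite ordE big1 ?addr0 ?Deff// => d yd; apply: germ_slope.
    by apply: germ_inward => // yo; apply: no; exists d.
  have [_ yd _] := yo.
  rewrite ordE (bigD1 d)//= big1 ?addr0 => [|d' /andP[yd' dd']].
    have -> : sl fire y d = -1 by apply/germ_slope/germ_outward.
    by rewrite subr_ge0 -gtz0_ge1 lt_neqAle eq_sym (Xboundary yo) Deff.
  apply/germ_slope/germ_inward => // yo'.
  by move/eqP: dd'; apply; exact: Xout1 yo' yo.
- have [_ xd _] := xo; have hr := tube_room xo h0 h2.
  rewrite E ord_ray// addr_ge0 ?Deff//.
  rewrite /sl (germ_slope (germ_tube_fwd xo h0 h2)) (germ_slope (germ_tube_bwd xo h0 h2)).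
  by rewrite subr_gt0 subr_ge0; case: (ltgtP h eps).
- rewrite ordE big1 ?addr0 ?Deff// => d yd; apply: germ_slope.
  exact: germ_away.
Qed.

Lemma fire_sect : exists2 g, sect D g &
  (forall y, X y -> g y = eps) /\ (forall y, ~ X y -> g y < eps).
Proof.
exists fire => //; split=> y Xy; first exact: fireX.
have [//|[[x [d [h [xo h0 h2 E]]]]|[_ Ty]]] := cases y.
  by rewrite E (fire_outward xo) ?h2 ?(ltW h0)// gt_max e0; lra.
by rewrite fire0.
Qed.

End Tent.

Lemma firing : exists g eps, [/\ sect D g,
  forall y, X y -> g y = eps & forall y, ~ X y -> g y < eps].
Proof.
have [eps He] := collar_exists; have [g gD [gX gNX]] := fire_sect He.
by exists g, eps.
Qed.

End Firing.

(** * The special open set of a reduced divisor *)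

Section SpecialComponent.
Context {R : realType} {G : metric_graph R}.
Implicit Types (x y v : gpoint G) (d : edge G * bool) (h k r : R) (X : set (gpoint G)).

Lemma connected_ray x d a b : connected (ray x d @` `[a, b]).
Proof.
apply: connected_continuous_connected; first exact: segment_connected.
exact/continuous_subspaceT/ray_continuous.
Qed.

Lemma segment_ray X x d : outward X x d -> exists eta, [/\ 0 < eta, eta < room x d,
    segment_from x ((fun t => ray x d (eta * t)) @` `]0, 1[) &
    (fun t => ray x d (eta * t)) @` `]0, 1[ `<=` ~` X].
Proof.
move=> [Xx xd [eps e0 He]]; have rm := room_gt0 xd.
pose eta := Num.min eps (room x d / 2).
have eta0 : 0 < eta by rewrite lt_min e0; lra.
have etae : eta <= eps by rewrite ge_min lexx.
have etar : eta <= room x d / 2 by rewrite ge_min lexx orbT.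
exists eta; split => //; first by lra.
- exists (fun t => ray x d (eta * t)); split => //.
  + apply: continuous_subspaceT => t.
    apply: (@continuous_comp _ _ _ (fun t => eta * t) (ray x d)).
      by apply: cvgM; [exact: cvg_cst|exact: cvg_id].
    exact: ray_continuous.
  + move=> s t; rewrite !in_itv/= => /andP[s0 s1] /andP[t0 t1].
    have bd z : 0 < z -> z <= 1 -> 0 < eta * z < room x d.
      move=> z0 z1; rewrite mulr_gt0//= (@le_lt_trans _ _ eta)//; last by lra.
      by rewrite ler_piMr// ltW.
    move: s0 t0; rewrite !le_eqVlt => /predU1P[<-|s0] /predU1P[<-|t0] //.
    * by rewrite mulr0 ray0// => /esym /(ray_neq xd (bd _ t0 t1)).
    * by rewrite mulr0 ray0// => /(ray_neq xd (bd _ s0 s1)).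
    * move=> /(ray_inj xd (bd _ s0 s1) (bd _ t0 t1)).
      exact/mulfI/lt0r_neq0.
  + by rewrite mulr0 ray0.
- move=> y [t /=]; rewrite in_itv/= => /andP[t0 t1] <-; apply: He.
  by rewrite mulr_gt0//= (le_trans _ etae)// ler_piMr// ltW.
Qed.

Lemma outdeg_ge2 X x d d' : outward X x d -> outward X x d' -> d != d' ->
  (2%:E <= outdeg X x)%E.
Proof.
move=> xo xo' dd; have [a [a0 ar sa aX]] := segment_ray xo.
have [b [b0 br sb bX]] := segment_ray xo'.
apply: ereal_sup_ubound; exists 2%N => //=.
exists (fun i : 'I_2 => if i == ord0 then (fun t => ray x d (a * t)) @` `]0, 1[
   else (fun t => ray x d' (b * t)) @` `]0, 1[); split; first by move=> i; case: ifP.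
have disj y : ~ (((fun t => ray x d (a * t)) @` `]0, 1[) y /\
    ((fun t => ray x d' (b * t)) @` `]0, 1[) y).
  move=> [[s /= + <-] [t /= +]]; rewrite !in_itv/= => /andP[s0 s1] /andP[t0 t1] /esym.
  have [_ xd _] := xo; have [_ xd' _] := xo'.
  apply: ray_disjoint => //.
    by rewrite mulr_gt0//= (lt_trans _ ar)// gtr_pMr.
  by rewrite mulr_gt0//= (lt_trans _ br)// gtr_pMr.
move=> i j _ _; case: ifPn => [/eqP ->|i0]; case: ifPn => [/eqP -> //|j0] [y yij].
- by case: (disj y).
- by case: (disj y); case: yij.
- apply: val_inj; move: i0 j0; rewrite -!val_eqE/=.
  by case: i j {yij} => [[|[|i]] ?]// [[|[|j]] ?].
Qed.

Lemma outward_boundary X x d : outward X x d -> (X `&` boundary X) x.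
Proof.
move=> [Xx xd [eps e0 He]]; split=> //; split; first exact: subset_closure.
move=> /nbhs_radial[_ [a a0 Ha]].
pose m := Num.min eps a / 2.
have m0 : 0 < Num.min eps a by rewrite lt_min e0.
have me : Num.min eps a <= eps by rewrite ge_min lexx.
have ma : Num.min eps a <= a by rewrite ge_min lexx orbT.
by apply: (He m); rewrite ?/m; [lra|apply: Ha; rewrite ?/m //; lra].
Qed.

Variables (D : divisor G) (v : gpoint G).
Hypothesis Deff : effective D.
Hypothesis Dv : coeff v D = 0.
Hypothesis vmax : forall g, sect D g -> forall x, g x <= g v.

Let U := connected_component (~` supp D) v.

Let WE x : (~` supp D) x <-> coeff x D = 0.
Proof.
by rewrite /supp/=; split => [/negP/negPn/eqP//|->]; rewrite eqxx.
Qed.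

Let comp_ray x d r h h' : star D x r -> dirs x d -> 0 < h <= r -> 0 < h' <= r ->
  connected_component (~` supp D) (ray x d h) (ray x d h').
Proof.
move=> xr xd hr hr'.
apply: (@connected_component_max _ _ (ray x d @` `[Num.min h h', Num.max h h'])).
- by exists h => //=; rewrite in_itv/= ge_min le_max lexx.
- move=> _ [t /= + <-]; rewrite in_itv/= ge_min le_max => ht.
  by apply/WE; apply: (xr.2 d xd).2; lra.
- exact: connected_ray.
- by exists h' => //=; rewrite in_itv/= ge_min le_max lexx !orbT.
Qed.

Let comp_ray0 x d r h : coeff x D = 0 -> star D x r -> dirs x d -> 0 <= h <= r ->
  connected_component (~` supp D) x (ray x d h).
Proof.
move=> Dx xr xd hr.
apply: (@connected_component_max _ _ (ray x d @` `[0, h])).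
- by exists 0; [rewrite /= in_itv/= lexx; case/andP: hr|rewrite ray0].
- move=> _ [t /= + <-]; rewrite in_itv/= => /andP[]; rewrite le_eqVlt => /predU1P[<- _|t0 th].
    by rewrite ray0//; apply/WE.
  by apply/WE; apply: (xr.2 d xd).2; lra.
- exact: connected_ray.
- by exists h => //=; rewrite in_itv/= lexx andbT; case/andP: hr.
Qed.

Let U_coeff x : U x -> coeff x D = 0.
Proof. by move=> /connected_component_sub /WE. Qed.

Let U_open : open U.
Proof.
apply: radial_open => x Ux; have [r xr] := star_exists D x.
exists r; first by case: xr.
move=> d h xd h0 hr; apply: (connected_component_trans Ux).
by apply: (comp_ray0 (U_coeff Ux) xr xd); rewrite h0 ltW.
Qed.

Let Uv : U v.
Proof. exact/connected_component_refl/WE. Qed.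

Let ray_into (X0 : gpoint G) x d r : star D x r -> dirs x d ->
  connected_component (~` U) X0 x -> ~ U (ray x d r) ->
  forall h, 0 < h <= r -> connected_component (~` U) X0 (ray x d h).
Proof.
move=> xr xd Xx NU h hr; have r0 : 0 < r by case: xr.
apply: (connected_component_trans Xx).
have NUx : ~ U x := connected_component_sub Xx.
apply: (@connected_component_max _ _ (ray x d @` `[0, r])).
- by exists 0; [rewrite /= in_itv/= lexx ltW|rewrite ray0].
- move=> _ [t /= + <-]; rewrite in_itv/= => /andP[]; rewrite le_eqVlt => /predU1P[<- _|t0 tr].
    by rewrite ray0.
  move=> Ut; apply: NU; apply: (connected_component_trans Ut).
  by apply: (comp_ray xr xd); rewrite ?t0// r0 lexx.
- exact: connected_ray.
- by exists h => //=; rewrite in_itv/=; lra.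
Qed.

Lemma special_component : special_open U.
Proof.
split; [exact: U_open|exact: component_connected|].
apply: Or33 => x0 NUx0 X; apply: contrapT => no.
have XU x : X x -> ~ U x by exact: connected_component_sub.
have Xx0 : X x0 by exact: connected_component_refl.
have Xcl : closed X by apply/component_closed/open_closedC/U_open.
have Xin x d : X x -> dirs x d -> ~ outward X x d ->
    exists2 eps, 0 < eps & forall h, 0 < h <= eps -> X (ray x d h).
  move=> Xx xd xo; have [r xr] := star_exists D x; have r0 : 0 < r by case: xr.
  exists r => // h hr; apply: (ray_into xr xd Xx _ hr) => Ur; apply: xo; split => //.
  exists r => // k kr /XU; apply; apply: (connected_component_trans Ur).
  by apply: (comp_ray xr xd); rewrite ?kr// r0 lexx.
have Xbd x d : outward X x d -> coeff x D != 0.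
  move=> [Xx xd [eps e0 He]]; apply/eqP => Dx.
  have [r xr] := star_exists D x; have r0 : 0 < r by case: xr.
  have NUr : ~ U (ray x d r).
    move=> Ur; apply: (XU _ Xx); apply: (connected_component_trans Ur).
    by apply/connected_component_sym/(comp_ray0 Dx xr xd); rewrite ltW/=.
  have m0 : 0 < Num.min eps r by rewrite lt_min e0.
  have me : Num.min eps r <= eps by rewrite ge_min lexx.
  have mr : Num.min eps r <= r by rewrite ge_min lexx orbT.
  apply: (He (Num.min eps r)); first by rewrite m0.
  by apply: (ray_into xr xd Xx NUr); rewrite m0.
have Xout1 x d d' : outward X x d -> outward X x d' -> d = d'.
  move=> xo xo'; apply/eqP; apply: contrapT => /negP dd; apply: no; exists x.
    exact: outward_boundary xo.
  exact: outdeg_ge2 xo xo' dd.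
have [g [eps [gD gX gNX]]] := firing Deff Xcl Xin Xbd Xout1.
have := vmax gD x0; rewrite (gX x0)// leNgt gNX// => /XU; exact.
Qed.

Lemma component_ord0 g x : sect D g -> U x -> ord g x = 0.
Proof.
move=> gD Ux; have gpl := gD.1.
have flat y : U y -> g y = g v -> forall d, dirs y d -> sl g y d = 0.
  move=> Uy gy.
  have sl_le0 d : dirs y d -> 0 <= - sl g y d.
    move=> yd; have [eps e0 He] := slP gpl yd.
    have := vmax gD (ray y d eps); rewrite He ?(ltW e0) ?lexx// gy gerDl.
    by rewrite pmulr_lle0// lerz0 oppr_ge0.
  have : \sum_(d | dirs y d) - sl g y d == 0.
    rewrite eq_le sumr_ge0// andbT sumrN -ordE oppr_le0.
    by have := gD.2 y; rewrite (U_coeff Uy) add0r.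
  rewrite psumr_eq0// => /allP H d yd.
  by have := H d (mem_index_enum _); rewrite yd oppr_eq0 => /eqP.
suff gU : g x = g v by rewrite ordE big1// => d; exact: flat.
pose S := [set y | U y /\ g y = g v].
suff : S = U by move=> SU; have [] : S x by rewrite SU.
have Uconn : connected U by exact: component_connected.
apply: Uconn; first by exists v.
- exists S; last by apply/esym/setIidPr => y [].
  apply: radial_open => y [Uy gy].
  have [eps e0 He] := pl_star y gpl.
  have : nbhs y U by apply: open_nbhs_nbhs; split.
  move=> /nbhs_radial[_ [a a0 Ha]].
  exists (Num.min eps a) => [|d h yd h0]; first by rewrite lt_min e0.
  rewrite lt_min => /andP[he ha]; split; first exact: Ha.
  by rewrite He ?h0 ?(ltW he)// (flat y Uy gy d yd) mul0r addr0.
- exists (~` [set y | U y /\ g y < g v]).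
  + apply: open_closedC; apply: openI; first exact: U_open.
    have /continuousP/(_ _ (@open_lt _ (g v))) := pl_continuous gpl.
    exact.
  + apply/seteqP; split => y.
      by move=> [Uy gy]; split => // -[_]; rewrite gy ltxx.
    move=> [Uy /= H]; split => //; apply/eqP; rewrite eq_le vmax//= leNgt.
    by apply/negP => H'; apply: H.
Qed.

End SpecialComponent.

(** * Rank-determining sets *)

Section RankDetermining.
Context {R : realType} {G : metric_graph R}.
Implicit Types (x : gpoint G) (D E : divisor G) (A : set (gpoint G)).
Implicit Types (l : seq (gpoint G)).

Lemma lin_equiv_sect D D' : linsys D D' ->
  exists2 f, sect D f & forall x, coeff x D' = coeff x D + ord f x.
Proof.
move=> [D'eff [f /rational_function_pl fpl fD]].
have E x : coeff x D' = coeff x D + ord (fun y => - f y) x.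
  by rewrite ordN// -fD coeffB opprB subrKC.
exists (fun y => - f y) => //; split; first exact: plN.
by move=> x; rewrite -E.
Qed.

Lemma supp_linsysP D x : supp_linsys D x <-> linsys (D - << x >>) !=set0.
Proof.
split=> [[D' [D'eff [f fr fD]] D'x]|[D' [D'eff [f fr fD]]]].
  exists (D' - << x >>); split; last by exists f => // y; rewrite opprB addrA subrK.
  move=> y; rewrite coeffB coeffU mul1r.
  case: eqVneq => [<-|_]; last by rewrite subr0.
  by rewrite subr_ge0 -gtz0_ge1 lt_neqAle eq_sym D'x D'eff.
exists (D' + << x >>).
  split; last by exists f => // y; rewrite opprD addrA addrAC.
  move=> y; rewrite coeffD coeffU mul1r addr_ge0//; by [exact: D'eff|case: eqP].
rewrite /supp/= coeffD coeffU mul1r eqxx gt_eqF// ltr_wpDl//; exact: D'eff.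
Qed.

Lemma effective_sum E (s : nat) : effective E -> deg E = s%:Z ->
  exists2 l, size l = s & E = \sum_(x <- l) << x >>.
Proof.
elim: s E => [|s ih] E Eeff dE.
  by exists [::]; rewrite // big_nil; apply: fgpos_eq0P => //; apply/fgposP.
have [x xE] : exists x, x \in dom E.
  case E0 : (dom E) => [|x l]; last by exists x; rewrite mem_head.
  by move: E0 dE => /eqP; rewrite dom_eq0 => /eqP ->; rewrite deg0.
have [||l ls lE] := ih (E - << x >>).
- move=> y; rewrite coeffB coeffU mul1r.
  case: eqVneq => [<-|_]; last by rewrite subr0.
  by rewrite subr_ge0 -gtz0_ge1 lt_neqAle eq_sym Eeff -mem_dom xE.
- by rewrite degB degU dE; lia.
by exists (x :: l); rewrite /= ?ls// big_cons -lE subrKC.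
Qed.

Lemma linsys_exchange A D l1 l2 : Lset A = setT ->
  (forall l, {in l, forall x, A x} -> size l = (size l1 + size l2)%N ->
     linsys (D - \sum_(x <- l) << x >>) !=set0) ->
  {in l2, forall x, A x} -> linsys (D - \sum_(x <- l1 ++ l2) << x >>) !=set0.
Proof.
move=> LA; elim: l1 l2 => [|x l1 ih] l2 HA l2A; first exact: HA.
rewrite /= big_cons opprD addrCA addrC -supp_linsysP.
have : Lset A x by rewrite LA.
apply=> a Aa; apply/supp_linsysP.
have -> : D - \sum_(x <- l1 ++ l2) << x >> - << a >> =
    D - \sum_(x <- l1 ++ (a :: l2)) << x >>.
  by rewrite !big_cat big_cons/= -addrA -opprD addrAC addrA.
apply: ih => [l lA ls|y]; first by apply: HA => //; rewrite ls/= addnS.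
by rewrite inE => /predU1P[->|/l2A].
Qed.

Lemma Lset_rank_determining A : Lset A = setT -> rank_determining A.
Proof.
move=> LA D; rewrite /rank /rank_on; case: ifP => // _.
congr (ereal_sup [set _ | _ in _]); apply/seteqP; split=> s /= Hs E Eeff.
  by move=> _; apply: Hs.
move=> _ dE; have [l ls ->] := effective_sum Eeff dE.
rewrite -[l]cats0; apply: (@linsys_exchange A) => // l' l'A l's.
apply: Hs.
- by move=> x; rewrite raddf_sum/= sumr_ge0// => y _; rewrite coeffU mul1r; case: eqP.
- move=> x; rewrite /supp/= raddf_sum/= => /eqP xl'.
  have [xl|xl] := boolP (x \in l'); first exact: l'A.
  exfalso; apply: xl'; rewrite big_seq big1// => y yl'.
  by rewrite coeffU mul1r; case: eqP yl' xl => [->->|].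
- rewrite raddf_sum/=; under eq_bigr do rewrite degU.
  by rewrite -ls addn0 in l's *; rewrite big_const_seq count_predT iter_addr_0 l's natz.
Qed.

End RankDetermining.

Lemma special_open_Lset (R : realType) (G : metric_graph R) (A : set (gpoint G)) v :
  A !=set0 ->
  (forall U : set (gpoint G), special_open U -> U v -> A `&` U !=set0) -> Lset A v.
Proof.
move=> [a0 Aa0] HA D AD; apply: contrapT => Nv.
have [D1 D1D _] := AD _ Aa0; have [f1 f1D _] := lin_equiv_sect D1D.
have [|f0 [f0D f0v f0max]] := @maximal_sect R G D v; first by exists f1.
have [E Ef0] := pl_div f0D.1.
have D0E x : coeff x (D + E) = coeff x D + ord f0 x by rewrite coeffD Ef0.
have D0eff : effective (D + E) by move=> x; rewrite D0E; exact: f0D.2.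
have D0lin : linsys D (D + E).
  split=> //; exists (fun x => - f0 x); first exact/pl_rational_function/plN/f0D.1.
  move=> x; rewrite ordN; last exact: f0D.1.
  by rewrite opprD addrA subrr add0r coeffN Ef0.
have D0v : coeff v (D + E) = 0.
  by apply/eqP; apply: contrapT => /negP D0v; apply: Nv; exists (D + E).
have vmax g : sect (D + E) g -> forall x, g x <= g v.
  move=> [gpl gD] x; have gvpl := plD gpl (pl_cst (- g v)).
  have := f0max (fun x => f0 x + (g x + - g v)) _ _ x.
  have -> : f0 v + (g v - g v) = 0 by rewrite subrr addr0.
  rewrite gerDl subr_le0; apply=> //; split; first exact: plD f0D.1 gvpl.
  move=> y; rewrite ordD//; last exact: f0D.1.
  rewrite ordD//; last exact: pl_cst.
  by rewrite ord_cst addr0 addrA -D0E.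
have [|a [Aa Ua]] := HA _ (special_component D0eff D0v vmax).
  by apply: connected_component_refl; rewrite /supp/= D0v eqxx.
have [D' D'D D'a] := AD _ Aa; have [f fD fE] := lin_equiv_sect D'D.
pose g x := f x + - f0 x.
have f0N := plN f0D.1.
have gE x : coeff x (D + E) + ord g x = coeff x D'.
  by rewrite /g ordD ?ordN// ?D0E ?fE; [lia|exact: f0D.1|exact: fD.1].
have gD : sect (D + E) g.
  by split=> [|x]; [exact: plD fD.1 f0N|rewrite gE; exact: D'D.1].
have aD0 : coeff a (D + E) = 0.
  by have := connected_component_sub Ua; rewrite /supp/= => /negP/negPn/eqP.
move: D'a; rewrite /supp/= -gE aD0 (component_ord0 D0v vmax gD Ua).
by rewrite addr0 eqxx.
Qed.

Theorem theorem3p8 (R : realType) (G : metric_graph R) (A : set (gpoint G))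
    (A_neq0 : A !=set0) :
  [/\ forall v : gpoint G,
        (forall U : set (gpoint G), special_open U -> U v -> A `&` U !=set0) ->
        Lset A v,
      \bigcap_(U in [set U : set (gpoint G) | special_open U /\ U `&` A = set0])
        (~` U) `<=` Lset A
    & (forall U : set (gpoint G), special_open U -> U !=set0 ->
        U `&` A !=set0) ->
      rank_determining A].
Proof.
have L v := @special_open_Lset R G A v A_neq0.
split=> // [v Hv|HA].
  apply: L => U Us Uv; apply/set0P/eqP => AU0.
  by apply: (Hv U) => //; split=> //; rewrite setIC.
apply: Lset_rank_determining; apply/seteqP; split=> // v _.
by apply: L => U Us Uv; rewrite setIC; apply: HA => //; exists v.
Qed.
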